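(* Let $G$ be a Lie group with Lie algebra $\mathfrak{g}$, and let $F$ be a left-invariant Randers metric on $G$ defined by the Riemannian metric $\widetilde a$ and the vector field $X$, i.e. $$F(x,y)=\sqrt{\widetilde a_x(y,y)}+\widetilde a_x(X,y),\qquad x\in G,\ y\in T_xG.$$ Then $F$ is of Berwald type if and only if $\mathrm{ad}_X:\mathfrak g\to\mathfrak g$ is skew-adjoint with respect to $\widetilde a$ and $\widetilde a(X,[\mathfrak g,\mathfrak g])=0$.
   Context: A Randers metric on a manifold $M$ defined by a Riemannian metric $\widetilde a$ and a vector field $X$ with $\widetilde a_x(X,X)<1$ for all $x\in M$ is the Finsler metric $F(x,y)=\sqrt{\widetilde a_x(y,y)}+\widetilde a_x(X,y)$. A Finsler metric $F$ on a Lie group is left-invariant if it is preserved by the tangent maps of all left translations. If such a Randers metric is left-invariant, then $\widetilde a$ and $X$ are left-invariant as well; thus $X$ is identified with an element of $\mathfrak g=T_eG$ and $\widetilde a$ with an inner product on $\mathfrak g$. A Finsler metric is of Berwald type if its Chern connection coefficients $\Gamma^i_{jk}(x,y)$ in natural coordinates do not depend on the direction $y$. *)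

(* Defs.v *)
From HB Require Import structures.
From mathcomp Require Import all_boot all_order all_algebra.
From mathcomp Require Import all_classical all_reals all_analysis.

Set Implicit Arguments.
Unset Strict Implicit.
Unset Printing Implicit Defensive.

Import Order.TTheory GRing.Theory Num.Theory.
Import numFieldNormedType.Exports.

Local Open Scope classical_set_scope.
Local Open Scope ring_scope.

Section Smoothness.
Context {R : realType} {V W : normedModType R}.

Definition iter_derive (f : V -> W) (s : seq V) : V -> W :=
  foldl (fun g v => fun x => 'D_v g x) f s.

(* C^oo on the open set U: f and all its iterated directional derivatives are
   (Frechet) differentiable, hence continuous, at every point of U. *)
Definition smooth_on (U : set V) (f : V -> W) : Prop :=
  forall (s : seq V) (x : V), U x -> differentiable (iter_derive f s) x.

End Smoothness.

(* [coord] and [cinv] are total functions; only their restrictions to [cdom]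
   and [coord @` cdom] carry information. *)
Record chart (R : realType) (n : nat) (M : topologicalType) := Chart {
  cdom : set M;
  coord :> M -> 'rV[R]_n;
  cinv : 'rV[R]_n -> M;
  cdom_open : open cdom;
  cimg_open : open (coord @` cdom);
  coordK : forall x, cdom x -> cinv (coord x) = x;
  coord_continuous : forall x, cdom x -> {for x, continuous coord};
  cinv_continuous : forall u, (coord @` cdom) u -> {for u, continuous cinv}
}.

Section Charts.
Context {R : realType} {n : nat} {M : topologicalType}.
Implicit Types c : chart R n M.

Definition cimg c : set 'rV[R]_n := c @` cdom c.

Definition smooth_transition c c' : Prop :=
  smooth_on [set u | cimg c u /\ cdom c' (cinv c u)] (c' \o cinv c).

Definition compatible c c' : Prop :=
  smooth_transition c c' /\ smooth_transition c' c.

End Charts.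

(* [chart_at] is an arbitrary choice of a chart around each point; it is only
   used to represent tangent spaces concretely (see [tangent]). *)
HB.mixin Record Topological_isSmoothManifold (R : realType) (n : nat) M
    of Topological M := {
  atlas : set (chart R n M);
  chart_at : M -> chart R n M;
  chart_at_atlas : forall x, atlas (chart_at x);
  chart_at_dom : forall x, cdom (chart_at x) x;
  atlas_compatible : forall c c', atlas c -> atlas c' -> compatible c c';
  atlas_maximal : forall c, (forall c', atlas c' -> compatible c c') -> atlas c;
  manifold_hausdorff : hausdorff_space M;
  manifold_second_countable : @second_countable M
}.

#[short(type="smoothManifoldType")]
HB.structure Definition SmoothManifold (R : realType) (n : nat) :=
  {M of Topological_isSmoothManifold R n M & Topological M}.

HB.mixin Record isLieGroup (R : realType) (n : nat) G
    of SmoothManifold R n G & Group G := {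
  lie_mul_continuous : continuous (fun p : G * G => (p.1 * p.2)%g);
  lie_inv_continuous : continuous (fun x : G => (x^-1)%g);
  lie_mul_smooth : forall c1 c2 c3 : chart R n G,
    atlas c1 -> atlas c2 -> atlas c3 ->
    smooth_on
      [set p : 'rV[R]_n * 'rV[R]_n | [/\ cimg c1 p.1, cimg c2 p.2
         & cdom c3 (cinv c1 p.1 * cinv c2 p.2)%g]]
      (fun p => c3 (cinv c1 p.1 * cinv c2 p.2)%g);
  lie_inv_smooth : forall c1 c2 : chart R n G, atlas c1 -> atlas c2 ->
    smooth_on
      [set u : 'rV[R]_n | cimg c1 u /\ cdom c2 ((cinv c1 u)^-1)%g]
      (fun u => c2 ((cinv c1 u)^-1)%g)
}.

#[short(type="lieGroupType")]
HB.structure Definition LieGroup (R : realType) (n : nat) :=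
  {G of isLieGroup R n G & SmoothManifold R n G & Group G}.

Section TangentSpaces.
Context {R : realType} {n : nat} {M : smoothManifoldType R n}.
Implicit Types (x : M) (c : chart R n M).

(* A tangent vector at x is represented by its components in the natural
   coordinates of the chart [chart_at x]. *)
Definition tangent x : Type := 'rV[R]_n.

Definition tangent_map (f : M -> M) x (v : tangent x) : tangent (f x) :=
  'd (chart_at (f x) \o f \o cinv (chart_at x)) (chart_at x x) v.

(* The tangent vector \sum_i y_i d/dx^i at the point of coordinates u in c. *)
Definition of_components c (u y : 'rV[R]_n) : tangent (cinv c u) :=
  'd (chart_at (cinv c u) \o cinv c) u y.

Definition components c x (v : tangent x) : 'rV[R]_n :=
  'd (c \o cinv (chart_at x)) (chart_at x x) v.

Definition local_field c (X : forall x, tangent x) (u : 'rV[R]_n) : 'rV[R]_n :=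
  components c (X (cinv c u)).

Definition smooth_vector_field (X : forall x, tangent x) : Prop :=
  forall c, atlas c -> smooth_on (cimg c) (local_field c X).

(* [X, Y]^i = X^j d_j Y^i - Y^j d_j X^i, in the chart [chart_at x]. *)
Definition lie_bracket (X Y : forall x, tangent x) x : tangent x :=
  let c := chart_at x in
  let X' := local_field c X in
  let Y' := local_field c Y in
  'D_(X' (c x)) Y' (c x) - 'D_(Y' (c x)) X' (c x).

Definition riemannian_metric (a : forall x, tangent x -> tangent x -> R) :
    Prop :=
  [/\ forall x (k : R) (v v' w : 'rV[R]_n),
        a x (k *: v + v') w = k * a x v w + a x v' w,
      forall x v w, a x v w = a x w v,
      forall x (v : 'rV[R]_n), v != 0 -> 0 < a x v v &
      forall c, atlas c -> forall v w : 'rV[R]_n,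
        smooth_on (cimg c)
          (fun u => a (cinv c u) (of_components c u v) (of_components c u w))].

Definition randers_metric (a : forall x, tangent x -> tangent x -> R)
    (X : forall x, tangent x) (F : forall x, tangent x -> R) : Prop :=
  [/\ riemannian_metric a,
      smooth_vector_field X,
      forall x, a x (X x) (X x) < 1 &
      forall x y, F x y = Num.sqrt (a x y y) + a x (X x) y].

End TangentSpaces.

Arguments tangent_map {R n M} f x v.

(* The Chern connection of a Finsler function L(u, y) given in natural
   coordinates (u, y) = (u^1, .., u^n, y^1, .., y^n); the sign and index
   conventions are those of Bao, Chern and Shen. *)
Section ChernConnection.
Context {R : realType} {n : nat}.
Local Notation vec := 'rV[R]_n.
Implicit Types (f L : vec -> vec -> R) (u y : vec) (i j k l s : 'I_n).

Definition partial_x f i u y : R := 'D_(delta_mx 0 i) (fun u' => f u' y) u.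

Definition partial_y f i u y : R := 'D_(delta_mx 0 i) (f u) y.

(* g_ij = (L^2 / 2)_{y^i y^j} *)
Definition fundamental L i j u y : R :=
  2^-1 * partial_y (partial_y (fun u' y' => L u' y' ^+ 2) i) j u y.

Definition fundamental_inv L u y : 'M[R]_n :=
  invmx (\matrix_(i, j) fundamental L i j u y).

(* C^i_jk = g^is C_sjk with C_sjk = (1/2) d g_sj / d y^k *)
Definition cartan L i j k u y : R :=
  \sum_s fundamental_inv L u y i s *
    (2^-1 * partial_y (fundamental L s j) k u y).

Definition formal_christoffel L i j k u y : R :=
  \sum_s fundamental_inv L u y i s *
    (2^-1 * (partial_x (fundamental L s j) k u y
             - partial_x (fundamental L j k) s u y
             + partial_x (fundamental L k s) j u y)).

(* N^i_j = gamma^i_jk y^k - C^i_jk gamma^k_rs y^r y^s *)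
Definition nonlinear_connection L i j u y : R :=
  \sum_k formal_christoffel L i j k u y * y 0 k
  - \sum_k cartan L i j k u y *
      (\sum_r \sum_s formal_christoffel L k r s u y * y 0 r * y 0 s).

(* delta/delta x^k = d/dx^k - N^l_k d/dy^l *)
Definition horizontal L f k u y : R :=
  partial_x f k u y
  - \sum_l nonlinear_connection L l k u y * partial_y f l u y.

Definition chern_coefficient L i j k u y : R :=
  \sum_s fundamental_inv L u y i s *
    (2^-1 * (horizontal L (fundamental L s j) k u y
             - horizontal L (fundamental L j k) s u y
             + horizontal L (fundamental L k s) j u y)).

End ChernConnection.

Section Berwald.
Context {R : realType} {n : nat} {M : smoothManifoldType R n}.

Definition local_finsler (c : chart R n M) (F : forall x : M, tangent x -> R)
    (u y : 'rV[R]_n) : R :=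
  F (cinv c u) (of_components c u y).

Definition berwald_type (F : forall x : M, tangent x -> R) : Prop :=
  forall c : chart R n M, atlas c ->
  forall u : 'rV[R]_n, cimg c u ->
  forall (i j k : 'I_n) (y y' : 'rV[R]_n), y != 0 -> y' != 0 ->
    chern_coefficient (local_finsler c F) i j k u y =
    chern_coefficient (local_finsler c F) i j k u y'.

End Berwald.

Section LieGroups.
Context {R : realType} {n : nat} {G : lieGroupType R n}.

Definition left_translation (g : G) : G -> G := fun x => (g * x)%g.

Definition left_invariant_metric (F : forall x : G, tangent x -> R) : Prop :=
  forall (g x : G) (y : tangent x),
    F (left_translation g x) (tangent_map (left_translation g) x y) = F x y.

Definition lie_algebra : Type := tangent (1%g : G).

(* The left-invariant vector field with value v at 1. The ascription uses that
   [tangent x] and [tangent (x * 1)] are convertible; since x * 1 = x, they are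
   also represented in the same chart. *)
Definition left_invariant_field (v : lie_algebra) (x : G) : tangent x :=
  tangent_map (left_translation x) 1%g v.

Definition ad (v w : lie_algebra) : lie_algebra :=
  lie_bracket (left_invariant_field v) (left_invariant_field w) 1%g.

Definition skew_adjoint (b : lie_algebra -> lie_algebra -> R)
    (T : lie_algebra -> lie_algebra) : Prop :=
  forall v w, b (T v) w = - b v (T w).

End LieGroups.

Arguments lie_algebra {R n} G.

(* Main.v *)
Require Import Defs.
From HB Require Import structures.
From mathcomp Require Import all_boot all_order all_algebra.
From mathcomp Require Import all_classical all_reals all_analysis.
From mathcomp Require Import ring lra.

Set Implicit Arguments.
Unset Strict Implicit.
Unset Printing Implicit Defensive.

Import Order.TTheory GRing.Theory Num.Theory.
Import numFieldNormedType.Exports.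

Local Open Scope classical_set_scope.
Local Open Scope ring_scope.

(** A left-invariant Randers metric is of Berwald type exactly when X is
    parallel for the Levi-Civita connection of the Riemannian metric, and for
    left-invariant data this is a condition on the Lie algebra.

    In a chart write A for the matrix of the metric, xi for the components of
    X, b = A xi for the dual form, and g for the fundamental tensor.  At a fixed
    (u, y) the Chern coefficients are characterized as the only symbols Ga,
    symmetric in their lower indices, that satisfy
      dg_ij/dx^k - Ga^l_kr y^r dg_ij/dy^l = Ga^l_ki g_lj + Ga^l_kj g_il
    ([chern_satisfies_equation], [chern_equation_unique]).  Apart from
    the symmetry and invertibility of g, this rests on y^s dg_sj/dy^l = 0, a
    consequence of homogeneity.

    Let alpha = sqrt (A_ij y^i y^j) and beta = b_i y^i.  If b is parallel, then
    A, b, and every tensor built from them and y is parallel along horizontal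
    directions, so the Christoffel symbols of A solve this equation for every y
    ([tensor_parallel]).  Conversely, if the coefficients do not depend on y,
    contracting the equation twice with y says that F = alpha + beta is
    horizontally constant; alpha is even and beta is odd in y, so each of them
    is, which says that Ga is the Levi-Civita connection and that b is parallel
    ([parallel_of_tensor]).  Hence [randers_berwald_parallel].

    The covariant derivative of b has an antisymmetric part, db, and a symmetric
    part, the Lie derivative of A along xi: b is parallel iff db = 0 and xi is a
    Killing field ([parallel_killing]).  Invariance of F passes to the metric and
    to X, because the norm is even and the form odd on each tangent space
    ([metric_invariant], [field_invariant]).  So in a left-invariant frame E_v the
    functions A(E_v, E_w) and b(E_w) are constant; differentiating them along
    the frame leaves only brackets, db = 0 becomes a(X, [v, w]) = 0, and the
    Killing equation becomes skewness of ad_X ([closed_frame], [killing_frame]).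
    Since the bracket of two left-invariant fields is again left-invariant, in
    every chart ([frame_bracket], which rests on the symmetry of second
    derivatives, [derive_comm]), the condition is the same at all points. *)

(** * Calculus: locality of the differential, symmetry of second derivatives *)
Section Calculus.
Context {R : realType}.

Lemma near_translate (V : normedModType R) (P : set V) x :
  (\forall z \near x, P z) -> \forall h \near (0 : V), P (h + x).
Proof. by move=> /nbhs0P; apply: filterS => h /=; rewrite addrC. Qed.

Lemma near_eq_diff (V W : normedModType R) (f g : V -> W) x :
  (\near x, f x = g x) -> differentiable f x ->
  differentiable g x /\ 'd g x = 'd f x :> (V -> W).
Proof.
move=> fg df.
have fg0 : \forall h \near (0 : V), f (h + x) = g (h + x).
  exact: (near_translate fg).
have H : g \o shift x = cst (g x) + 'd f x +o_ 0 id.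
  apply/eqaddoP => e e0.
  have /diff_locally/eqaddoP /(_ e e0) := df.
  apply: filter_app; near=> h => /=.
  by rewrite /= -(nbhs_singleton fg) !fctE/= (near fg0 h).
have dE := diff_unique (diff_continuous df) H.
by split => //; apply/diff_locallyP; rewrite dE; split; [exact: diff_continuous|exact: H].
Unshelve. all: by end_near. Qed.

Lemma is_derive_line (V W : normedModType R) (f : V -> W) (x v : V) (t : R) :
  differentiable f (t *: v + x) ->
  is_derive t 1 (fun s : R => f (s *: v + x)) ('D_v f (t *: v + x)).
Proof.
move=> df.
have H : is_diff t (fun s : R => s *: v + x) ( *:%R^~ v).
  have := @is_diffD _ _ _ _ _ _ _ t (is_diff_scalel t v) (is_diff_cst x t).
  by rewrite addr0.
have K := is_diff_comp H (differentiableP df).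
 apply: DeriveDef; first by apply: diff_derivable.
rewrite deriveE// (@deriveE _ _ _ f)//.
have -> : (fun s : R => f (s *: v + x)) = f \o (fun s : R => s *: v + x) by [].
by rewrite diff_val /= scale1r.
Qed.

Section Young.
Context {V : normedModType R}.

(** Applying the mean value theorem to s |-> f (s t v + t w + x) - f (s t v + x)
    turns the second difference into a first difference of 'D_v f at two points
    near x.  The differentiability of 'D_v f at x then suffices: this is Young's
    form of the theorem, with no continuity of the second derivatives. *)
Lemma second_difference (f : V -> R) (x v w : V) :
  (\forall z \near x, differentiable f z) -> differentiable ('D_v f) x ->
  (fun t : R => t ^- 2 * (f (t *: v + (t *: w + x)) - f (t *: v + x)
                          - f (t *: w + x) + f x)) @ 0^' --> 'D_w ('D_v f) x.
Proof.
move=> df dg; set g := 'D_v f.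
apply/cvgrPdist_le => e e0.
(* M bounds the displacement s t v + r t w by |t| M when s and r lie in [0, 1]. *)
pose M := `|v| + `|w| + 1.
have M0 : 0 < M by rewrite ltr_wpDl// addr_ge0.
have e'0 : 0 < e / (2 * M) by rewrite divr_gt0// mulr_gt0.
have df0 : \forall h \near (0 : V), differentiable f (h + x).
  exact: (near_translate df).
have /diff_locally/eqaddoP /(_ _ e'0) gb := dg.
have /nbhs_ballP[d /= d0 dP] : \forall h \near (0 : V), differentiable f (h + x) /\
  `|g (h + x) - g x - 'd g x h| <= e / (2 * M) * `|h|.
  near=> h; split; first by near: h.
  have : `|(('D_v f \o shift x) - (cst (g x) + 'd ('D_v f) x)) h| <= e / (2 * M) * `|id h|.
    by near: h.
  by rewrite /= !fctE /= opprD addrA.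
near=> t.
have t0 : t != 0 by near: t; exact: nbhs_dnbhs_neq.
have tM : `|t| * M < d.
  rewrite -ltr_pdivlMr//; near: t; apply: dnbhs0_lt; exact: divr_gt0.
have small (s r : R) : 0 <= s <= 1 -> 0 <= r <= 1 ->
    `|(s * t) *: v + (r * t) *: w| <= `|t| * M.
  move=> /andP[s0 s1] /andP[r0 r1].
  rewrite (le_trans (ler_normD _ _))// !normrZ ?normrM (ger0_norm s0) (ger0_norm r0) /M.
  rewrite [s * _]mulrC [r * _]mulrC -!mulrA -mulrDr ler_wpM2l//.
  have := normr_ge0 v; have := normr_ge0 w; move: (`|v|) (`|w|) => a b; nra.
have P (s r : R) : 0 <= s <= 1 -> 0 <= r <= 1 ->
    differentiable f (((s * t) *: v + (r * t) *: w) + x) /\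
    `|g (((s * t) *: v + (r * t) *: w) + x) - g x
       - 'd g x ((s * t) *: v + (r * t) *: w)| <= e / (2 * M) * (`|t| * M).
  move=> s01 r01; have sm := small s r s01 r01.
  have [|A B] := dP ((s * t) *: v + (r * t) *: w).
    by rewrite -ball_normE /= sub0r normrN (le_lt_trans sm).
  by split => //; rewrite (le_trans B)// ler_wpM2l// ltW.
pose F (r s : R) := f (s *: (t *: v) + ((r * t) *: w + x)).
have dF (r s : R) : 0 <= s <= 1 -> 0 <= r <= 1 ->
  is_derive s 1 (F r) (t * g (((s * t) *: v + (r * t) *: w) + x)).
  move=> s01 r01.
  have [D _] := P s r s01 r01.
  have E : s *: (t *: v) + ((r * t) *: w + x) = ((s * t) *: v + (r * t) *: w) + x.
    by rewrite scalerA addrA.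
  have D' : differentiable f (s *: (t *: v) + ((r * t) *: w + x)) by rewrite E.
  have := is_derive_line D'; rewrite E.
  by rewrite (@deriveE _ _ _ f)// linearZ /= -(@deriveE _ _ _ f).
have i0 : 0 <= (0 : R) <= 1 by rewrite lexx ler01.
have i1 : 0 <= (1 : R) <= 1 by rewrite lexx ler01.
have dphi (s : R) : 0 <= s <= 1 -> is_derive s 1 (F 1 - F 0)
    (t * g (((s * t) *: v + (1 * t) *: w) + x)
     - t * g (((s * t) *: v + (0 * t) *: w) + x)).
  by move=> s01; exact: is_deriveB (dF _ _ s01 i1) (dF _ _ s01 i0).
have [c c01 cE] := @MVT R (F 1 - F 0) _ 0 1 ltr01
  (fun s (h : s \in `]0, 1[%R) => dphi s (subset_itv_oo_cc h)) (derivable_within_continuous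
  (fun s (h : s \in `[0, 1]%R) => @ex_derive _ _ _ _ _ _ _ (dphi s h))).
have c01' : 0 <= c <= 1 by have := subset_itv_oo_cc c01.
have -> : f (t *: v + (t *: w + x)) - f (t *: v + x) - f (t *: w + x) + f x
   = (F 1 - F 0) 1 - (F 1 - F 0) 0.
  rewrite !fctE /F !scale0r !scale1r !mul1r !mul0r !scale0r !add0r.
  ring.
rewrite {}cE subr0 mulr1 -mulrBr.
have [_ B1] := P c 1 c01' i1.
have [_ B0] := P c 0 c01' i0.
rewrite (@deriveE _ _ _ g)//.
have dD p q : 'd g x (p + q) = 'd g x p + 'd g x q by exact: linearD.
have dZ (k : R) p : 'd g x (k *: p) = k *: 'd g x p by exact: linearZ.
move: B1 B0; rewrite !dD !dZ !mul1r !mul0r !scale0r !addr0.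
set g1 := g _; set g0 := g (_ + x); set gx := g x; set p := _ *: 'd g x v.
set q := 'd g x w => B1 B0.
have -> : q - t ^- 2 * (t * (g1 - g0)) =
   t^-1 * ((g0 - gx - p) - (g1 - gx - (p + t *: q))).
  by rewrite /GRing.scale/= expr2; field.
rewrite normrM normfV ler_pdivrMl ?normr_gt0//.
rewrite (le_trans (ler_normB _ _))// (le_trans (lerD B0 B1))//.
rewrite le_eqVlt; apply/orP; left; apply/eqP.
have MN : M != 0 by rewrite gt_eqF.
by field.
Unshelve. all: by end_near. Qed.

(** The second difference is symmetric in v and w, so its two limits agree. *)
Lemma derive_comm (f : V -> R) (x v w : V) :
  (\forall z \near x, differentiable f z) -> differentiable ('D_v f) x ->
  differentiable ('D_w f) x -> 'D_w ('D_v f) x = 'D_v ('D_w f) x.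
Proof.
move=> df dv dw.
have H1 := @second_difference f x v w df dv.
have H2 := @second_difference f x w v df dw.
suff E : (fun t : R => t ^- 2 * (f (t *: v + (t *: w + x)) - f (t *: v + x)
    - f (t *: w + x) + f x)) = (fun t : R => t ^- 2 *
    (f (t *: w + (t *: v + x)) - f (t *: w + x) - f (t *: v + x) + f x)).
  by move: H1; rewrite E => H1; exact: (cvg_unique _ H1 H2).
by apply/funext => t; rewrite [t *: v + (_ + _)]addrCA [X in _ * (X + _)]addrAC.
Qed.

End Young.

Lemma differentiable_entry (V : normedModType R) m p (g : V -> 'M[R]_(m, p)) z i j :
  differentiable g z -> differentiable (fun y => g y i j) z.
Proof.
move=> dg.
have := @differentiable_comp R V _ _ g (fun N : 'M[R]_(m, p) => N i j : R) z dg.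
by apply; exact: differentiable_coord.
Qed.

Lemma derive_entry (V : normedModType R) m p (g : V -> 'M[R]_(m, p)) z v i j :
  differentiable g z -> 'D_v (fun y => g y i j) z = ('D_v g z) i j.
Proof. by move=> dg; rewrite derive_mx ?mxE//; exact: diff_derivable. Qed.

Lemma derive_comm_rV (V : normedModType R) m (f : V -> 'rV[R]_m) (x v w : V) :
  (\forall z \near x, differentiable f z) -> differentiable ('D_v f) x ->
  differentiable ('D_w f) x -> 'D_w ('D_v f) x = 'D_v ('D_w f) x.
Proof.
move=> df dv dw; apply/rowP => j.
have E y : \forall z \near x, ('D_y f z) 0 j = 'D_y (fun z => f z 0 j) z.
  by apply: filterS df => z dz; rewrite derive_entry.
have N y : differentiable ('D_y f) x ->
    differentiable ('D_y (fun z => f z 0 j)) x.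
  by move=> dy; have [] := near_eq_diff (E y) (differentiable_entry 0 j dy).
have A y y' : differentiable ('D_y f) x ->
    ('D_y' ('D_y f) x) 0 j = 'D_y' ('D_y (fun z => f z 0 j)) x.
  move=> dy; exact: etrans (esym (derive_entry y' 0 j dy)) (near_eq_derive y' (E y)).
apply: etrans (A _ _ dv) (etrans _ (esym (A _ _ dw))).
apply: derive_comm; [|exact: N|exact: N].
by apply: filterS df => z; exact: differentiable_entry.
Qed.

Lemma is_derive1P (V W : normedModType R) (f : V -> W) x v df :
  is_derive x v f df <-> is_derive (0 : R) (1 : R) (fun h => f (h *: v + x)) df.
Proof.
have E : 'D_v f x = 'D_1 (fun h : R => f (h *: v + x)) 0.
  rewrite /derive; set g1 := fun h => h^-1 *: _; set g2 := fun h => h^-1 *: _.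
  suff -> : g1 = g2 by [].
  by rewrite funeqE /g1 /g2 => h /=; rewrite addr0 scale0r add0r [_%:A]mulr1.
split=> -[d <-]; split; rewrite ?E//.
  exact: (derivable1P f x v).1.
exact: (derivable1P f x v).2.
Qed.

Lemma is_derive_sqrt_comp (V : normedModType R) (f : V -> R) x v df :
  0 < f x -> is_derive x v f df ->
  is_derive x v (fun z => Num.sqrt (f z)) (df / (2 * Num.sqrt (f x))).
Proof.
move=> f0 /is_derive1P D; apply/is_derive1P.
have f0' : 0 < f (0 *: v + x) by rewrite scale0r add0r.
have := is_derive1_comp (is_derive1_sqrt f0') D.
by rewrite scale0r add0r mulrC.
Qed.

End Calculus.

(** * The Chern coefficients at one point, as linear algebra *)
Section KoszulFormula.
Context {R : realType} {n : nat}.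
Implicit Types (g : 'M[R]_n) (D Ga : 'I_n -> 'I_n -> 'I_n -> R).

(** The Christoffel symbols of g when D k i j stands for the derivative of g_ij
    along the k-th direction: with plain derivatives these are the formal
    Christoffel symbols, with horizontal ones the Chern coefficients. *)
Definition koszul g D i j k : R :=
  \sum_s invmx g i s * (2^-1 * (D k s j - D s j k + D j k s)).

Definition metric_compatible g D Ga : Prop :=
  forall k i j, D k i j =
    \sum_l Ga l k i * g l j + \sum_l Ga l k j * g l i.

Lemma koszul_sym g D i j k : (forall k i j, D k i j = D k j i) ->
  koszul g D i j k = koszul g D i k j.
Proof.
move=> Dsym; apply: eq_bigr => s _.
by rewrite (Dsym k s j) (Dsym s j k) (Dsym j k s); ring.
Qed.

Section Invertible.
Variable g : 'M[R]_n.
Hypotheses (gU : g \in unitmx) (gsym : forall i j, g i j = g j i).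

Lemma invmx_lower (Y : 'I_n -> R) m :
  \sum_i (\sum_s invmx g i s * Y s) * g i m = Y m.
Proof.
under eq_bigr do rewrite mulr_suml.
rewrite exchange_big /= (bigD1 m)//= [X in _ + X]big1 ?addr0 => [|s sm].
  transitivity (Y m * (g *m invmx g) m m); last by rewrite mulmxV// mxE eqxx mulr1.
  by rewrite mxE mulr_sumr; apply: eq_bigr => i _; rewrite (gsym m); ring.
transitivity (Y s * (g *m invmx g) m s).
  by rewrite mxE mulr_sumr; apply: eq_bigr => i _; rewrite (gsym m); ring.
by rewrite mulmxV// mxE eq_sym (negPf sm) mulr0.
Qed.

Lemma invmx_raise (Y : 'I_n -> R) i :
  \sum_s invmx g i s * (\sum_l Y l * g l s) = Y i.
Proof.
transitivity (((\row_l Y l) *m g *m (invmx g)) 0 i); last first.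
  by rewrite -mulmxA mulmxV// mulmx1 mxE.
rewrite mxE; apply: eq_bigr => s _; rewrite mxE mulrC.
have -> : invmx g i s = invmx g s i.
  have gT : g^T = g by apply/matrixP => a b; rewrite mxE gsym.
  by rewrite -[in RHS]gT -trmx_inv mxE.
by congr (_ * _); apply: eq_bigr => l _; rewrite mxE.
Qed.

Lemma koszul_compatible D : (forall k i j, D k i j = D k j i) ->
  metric_compatible g D (koszul g D).
Proof.
move=> Dsym k i j; rewrite !invmx_lower.
by rewrite (Dsym i j k) (Dsym i k j) (Dsym k j i) (Dsym j i k) (Dsym j k i); field.
Qed.

(** Permuting the three indices in the compatibility equations and combining
    them solves for Ga, as for the uniqueness of the Levi-Civita connection. *)
Lemma koszul_unique D Ga : (forall i j k, Ga i j k = Ga i k j) ->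
  metric_compatible g D Ga -> forall i j k, koszul g D i j k = Ga i j k.
Proof.
move=> Gsym DE i j k; rewrite /koszul -[RHS](invmx_raise (fun l => Ga l j k)).
apply: eq_bigr => s _; congr (_ * _); rewrite !DE.
have E (f f' : 'I_n -> R) (b : 'I_n) : f =1 f' ->
  \sum_l f l * g l b = \sum_l f' l * g l b.
  by move=> ff; apply: eq_bigr => l _; rewrite ff.
rewrite (E _ _ s (fun l => Gsym l k j)) (E _ _ k (fun l => Gsym l s j)).
by rewrite (E _ _ j (fun l => Gsym l s k)); field.
Qed.

End Invertible.
End KoszulFormula.

(** At a fixed (u, y) the Chern coefficients depend only on the arrays g,
    gx = dg/dx and gy = dg/dy.  Keeping these as free variables separates the
    algebra from the analysis.  The last index of [chern_cartan] is the one of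
    the vertical derivative. *)
Section ChernAlgebra.
Context {R : realType} {n : nat}.
Variables (g : 'M[R]_n) (gx gy : 'I_n -> 'I_n -> 'I_n -> R) (y : 'rV[R]_n).

Definition chern_cartan i j k : R :=
  \sum_s invmx g i s * (2^-1 * gy k s j).

Definition chern_nonlinear i j : R :=
  \sum_k koszul g gx i j k * y 0 k
  - \sum_k chern_cartan i j k *
      (\sum_r \sum_s koszul g gx k r s * y 0 r * y 0 s).

Definition horizontal_metric (M : 'I_n -> 'I_n -> R) k i j : R :=
  gx k i j - \sum_l M l k * gy l i j.

Definition chern_symbol : 'I_n -> 'I_n -> 'I_n -> R :=
  koszul g (horizontal_metric chern_nonlinear).

Hypotheses (gU : g \in unitmx) (gsym : forall i j, g i j = g j i).
Hypotheses (gxsym : forall k i j, gx k i j = gx k j i).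
Hypotheses (gysym : forall l i j, gy l i j = gy l j i).
Hypothesis gy_radial : forall l j, \sum_s y 0 s * gy l s j = 0.

Lemma horizontal_metric_sym M k i j :
  horizontal_metric M k i j = horizontal_metric M k j i.
Proof.
rewrite /horizontal_metric (gxsym k i j).
by under eq_bigr do rewrite (gysym _ i j).
Qed.

Lemma cartan_radial i k : \sum_j chern_cartan i j k * y 0 j = 0.
Proof.
under eq_bigr do rewrite /chern_cartan mulr_suml.
rewrite exchange_big /=; apply: big1 => s _.
transitivity (invmx g i s * 2^-1 * \sum_j y 0 j * gy k j s).
  rewrite mulr_sumr; apply: eq_bigr => j _; rewrite (gysym k j s); ring.
by rewrite gy_radial mulr0.
Qed.

(** Of the three vertical terms in the Koszul formula, contraction with y kills
    the two that are of the form y^s dg_sj/dy^l. *)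
Lemma koszul_horizontal_contract M i j :
  \sum_k koszul g (horizontal_metric M) i j k * y 0 k =
  \sum_k koszul g gx i j k * y 0 k
  - \sum_k chern_cartan i j k * (\sum_r M k r * y 0 r).
Proof.
pose E s k := \sum_l M l k * gy l s j - \sum_l M l s * gy l j k + \sum_l M l j * gy l k s.
have KE k : koszul g (horizontal_metric M) i j k =
    koszul g gx i j k - \sum_s invmx g i s * (2^-1 * E s k).
  rewrite -sumrB; apply: eq_bigr => s _.
  by rewrite /horizontal_metric /E; ring.
under eq_bigr do rewrite KE mulrBl.
rewrite sumrB; congr (_ - _).
under eq_bigr do rewrite mulr_suml.
rewrite exchange_big /=.
have ES s : \sum_k E s k * y 0 k = \sum_l (\sum_r M l r * y 0 r) * gy l s j.
  have Z c d : \sum_k (\sum_l M l c * gy l k d) * y 0 k = 0.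
    under eq_bigr do rewrite mulr_suml.
    rewrite exchange_big /=; apply: big1 => l _.
    transitivity (M l c * \sum_k y 0 k * gy l k d); last by rewrite gy_radial mulr0.
    by rewrite mulr_sumr; apply: eq_bigr => k _; ring.
  transitivity (\sum_k ((\sum_l M l k * gy l s j) * y 0 k
     - (\sum_l M l s * gy l k j) * y 0 k + (\sum_l M l j * gy l k s) * y 0 k)).
    apply: eq_bigr => k _; rewrite /E -mulrBl -mulrDl; congr ((_ - _ + _) * _).
    by apply: eq_bigr => l _; rewrite gysym.
  rewrite big_split /= sumrB !Z subr0 addr0.
  under eq_bigr do rewrite mulr_suml.
  rewrite exchange_big /=; apply: eq_bigr => l _.
  by rewrite mulr_suml; apply: eq_bigr => k _; ring.
transitivity (\sum_s invmx g i s * (2^-1 * \sum_l (\sum_r M l r * y 0 r) * gy l s j)).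
  apply: eq_bigr => s _; rewrite -ES !mulr_sumr; apply: eq_bigr => k _.
  by ring.
transitivity (\sum_s \sum_l (invmx g i s * (2^-1 * gy l s j)) * (\sum_r M l r * y 0 r)).
  by apply: eq_bigr => s _; rewrite !mulr_sumr; apply: eq_bigr => l _; ring.
rewrite exchange_big /=; apply: eq_bigr => l _.
by rewrite -mulr_suml.
Qed.

Lemma koszul_horizontal_contract2 M i :
  \sum_j (\sum_k koszul g (horizontal_metric M) i j k * y 0 k) * y 0 j =
  \sum_r \sum_s koszul g gx i r s * y 0 r * y 0 s.
Proof.
under eq_bigr do rewrite koszul_horizontal_contract mulrBl.
rewrite sumrB [X in _ - X](_ : _ = 0) ?subr0.
  by apply: eq_bigr => j _; rewrite mulr_suml; apply: eq_bigr => k _; ring.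
under eq_bigr do rewrite mulr_suml.
rewrite exchange_big /=; apply: big1 => k _.
transitivity ((\sum_j chern_cartan i j k * y 0 j) * (\sum_r M k r * y 0 r)).
  by rewrite mulr_suml; apply: eq_bigr => j _; ring.
by rewrite cartan_radial mul0r.
Qed.

Lemma nonlinear_connection_radial i :
  \sum_j chern_nonlinear i j * y 0 j =
  \sum_r \sum_s koszul g gx i r s * y 0 r * y 0 s.
Proof.
under eq_bigr do rewrite /chern_nonlinear mulrBl.
rewrite sumrB [X in _ - X](_ : _ = 0) ?subr0.
  by apply: eq_bigr => j _; rewrite mulr_suml; apply: eq_bigr => k _; ring.
under eq_bigr do rewrite mulr_suml.
rewrite exchange_big /=; apply: big1 => k _; set S := \sum_r \sum_s _.
transitivity ((\sum_j chern_cartan i j k * y 0 j) * S).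
  by rewrite mulr_suml; apply: eq_bigr => j _; ring.
by rewrite cartan_radial mul0r.
Qed.

(** The Chern coefficients recover the nonlinear connection: both are the
    contraction of the formal Christoffel symbols with y, corrected by the same
    Cartan term. *)
Lemma chern_contract i j :
  \sum_k chern_symbol i j k * y 0 k = chern_nonlinear i j.
Proof.
rewrite koszul_horizontal_contract; congr (_ - _).
by apply: eq_bigr => k _; rewrite nonlinear_connection_radial.
Qed.

Lemma chern_sym i j k :
  chern_symbol i j k = chern_symbol i k j.
Proof. exact: koszul_sym (horizontal_metric_sym _). Qed.

(** Horizontal metric compatibility, where the horizontal directions are those
    of the nonlinear connection Ga^l_kr y^r induced by Ga itself. *)
Definition chern_equation (Ga : 'I_n -> 'I_n -> 'I_n -> R) : Prop :=
  metric_compatible g (horizontal_metric (fun l k => \sum_r Ga l k r * y 0 r)) Ga.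

Lemma chern_satisfies_equation :
  chern_equation chern_symbol.
Proof.
rewrite /chern_equation.
under [X in horizontal_metric X]eq_fun do under eq_fun do rewrite chern_contract.
by apply: koszul_compatible => //; exact: horizontal_metric_sym.
Qed.

(** The unknown occurs on both sides, but a solution Ga is the Koszul symbol of
    its own horizontal derivatives; two contractions with y show that its
    nonlinear connection has the same spray as the Chern one, hence coincides
    with it. *)
Lemma chern_equation_unique Ga : (forall i j k, Ga i j k = Ga i k j) ->
  chern_equation Ga -> forall i j k, chern_symbol i j k = Ga i j k.
Proof.
move=> Gsym GE; pose M l k := \sum_r Ga l k r * y 0 r.
have GK i j k : Ga i j k = koszul g (horizontal_metric M) i j k.
  by rewrite (koszul_unique gU gsym Gsym GE).
have MN i j : M i j = chern_nonlinear i j.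
  rewrite /M; under eq_bigr do rewrite GK.
  rewrite koszul_horizontal_contract; congr (_ - _); apply: eq_bigr => k _.
  congr (_ * _); rewrite -(koszul_horizontal_contract2 M).
  by apply: eq_bigr => j' _; congr (_ * _); apply: eq_bigr => r _; rewrite GK.
move=> i j k; rewrite GK.
by congr (koszul g (horizontal_metric _) i j k); apply/funext => a; apply/funext => b.
Qed.

End ChernAlgebra.

(** * The fundamental tensor of a Randers norm *)
Section DeriveRules.
Context {R : realType} {V : normedModType R}.
Implicit Types (f g : V -> R) (z v : V).

Lemma is_derive_val (W : normedModType R) (f : V -> W) z v df :
  is_derive z v f df -> 'D_v f z = df.
Proof. by case. Qed.

Lemma is_derive_mul f g z v df dg : is_derive z v f df -> is_derive z v g dg ->
  is_derive z v (fun x => f x * g x) (df * g z + f z * dg).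
Proof.
move=> Hf Hg; apply: is_derive_eq (is_deriveM Hf Hg) _.
by rewrite /GRing.scale/=; ring.
Qed.

Lemma is_derive_add f g z v df dg : is_derive z v f df -> is_derive z v g dg ->
  is_derive z v (fun x => f x + g x) (df + dg).
Proof. by move=> Hf Hg; exact: is_deriveD. Qed.

Lemma is_derive_sub f g z v df dg : is_derive z v f df -> is_derive z v g dg ->
  is_derive z v (fun x => f x - g x) (df - dg).
Proof. by move=> Hf Hg; exact: is_deriveB. Qed.

Lemma is_derive_inv f z v df : f z != 0 -> is_derive z v f df ->
  is_derive z v (fun x => (f x)^-1) (- df / f z ^+ 2).
Proof.
move=> f0 [D <-]; split; first exact: derivableV.
by rewrite deriveV// /GRing.scale/=; field.
Qed.

Lemma is_derive_big n (f : 'I_n -> V -> R) z v (df : 'I_n -> R) :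
  (forall i, is_derive z v (f i) (df i)) ->
  is_derive z v (fun x => \sum_i f i x) (\sum_i df i).
Proof.
move=> H; have := is_derive_sum H.
by rewrite (_ : \sum_i f i = (fun x => \sum_i f i x))//; apply/funext => x; rewrite fct_sumE.
Qed.

End DeriveRules.

Section RandersTensor.
Context {R : realType} {n : nat}.
Implicit Types (A : 'M[R]_n) (b y : 'rV[R]_n) (i j l : 'I_n).

(** Lowering the index of y with A: the form A_ij y^j. *)
Definition low A y i : R := \sum_j A i j * y 0 j.
Definition lin b y : R := \sum_j b 0 j * y 0 j.
Definition quad A y : R := lin (\row_i low A y i) y.
Definition randers A b y : R := Num.sqrt (quad A y) + lin b y.
(** The derivative of the Randers norm along the i-th direction of y. *)
Definition slope A b y i : R := low A y i / Num.sqrt (quad A y) + b 0 i.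
(** The Hessian in y of L^2 / 2, where L is the Randers norm: the product of the
    slopes plus L times the Hessian of L. *)
Definition randers_tensor A b y i j : R :=
  slope A b y i * slope A b y j + randers A b y *
    (A i j / Num.sqrt (quad A y)
     - low A y i * low A y j / Num.sqrt (quad A y) ^+ 3).

(** Product-rule variations of [slope] and [randers_tensor]: dal, dL, daij, dpi
    and dbi are the variations of sqrt (quad A y), of the norm, and of the
    entries of A, of [low A y] and of b.  Treating them as independent numbers
    lets one formula serve for d/dx, d/dy and horizontal derivatives. *)
Definition slope_var A y (dal dpi dbi : R) i : R :=
  dpi / Num.sqrt (quad A y) - low A y i * dal / Num.sqrt (quad A y) ^+ 2 + dbi.

Definition tensor_var A b y (dal dL daij dpi dpj dbi dbj : R) i j : R :=
  let al := Num.sqrt (quad A y) in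
  slope_var A y dal dpi dbi i * slope A b y j
  + slope A b y i * slope_var A y dal dpj dbj j
  + dL * (A i j / al - low A y i * low A y j / al ^+ 3)
  + randers A b y * (daij / al - A i j * dal / al ^+ 2
     - (dpi * low A y j + low A y i * dpj) / al ^+ 3
     + low A y i * low A y j * (3 * dal) / al ^+ 4).

Lemma low_delta A l i : low A (delta_mx 0 l) i = A i l.
Proof.
rewrite /low (bigD1 l)//= mxE !eqxx mulr1 big1 ?addr0// => j jl.
by rewrite mxE (negPf jl) andbF mulr0.
Qed.

Lemma lin_delta b l : lin b (delta_mx 0 l) = b 0 l.
Proof.
rewrite /lin (bigD1 l)//= mxE !eqxx mulr1 big1 ?addr0// => j jl.
by rewrite mxE (negPf jl) andbF mulr0.
Qed.

Lemma low0l y i : low 0 y i = 0.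
Proof. by rewrite /low big1// => j _; rewrite mxE mul0r. Qed.

Lemma lin0l y : lin 0 y = 0.
Proof. by rewrite /lin big1// => j _; rewrite mxE mul0r. Qed.

Lemma low0r A i : low A 0 i = 0.
Proof. by rewrite /low big1// => j _; rewrite mxE mulr0. Qed.

Lemma lin0r b : lin b 0 = 0.
Proof. by rewrite /lin big1// => j _; rewrite mxE mulr0. Qed.

Lemma quad0l y : quad 0 y = 0.
Proof. by rewrite /quad /lin big1// => j _; rewrite mxE low0l mul0r. Qed.

(** A, b and y all depend on a point z of V, so that the same rules give the
    derivatives in u (with y constant) and in y (with A and b constant). *)
Section Variation.
Context {V : normedModType R}.
Variables (A : V -> 'M[R]_n) (b y : V -> 'rV[R]_n) (z v : V).
Variables (dA : 'M[R]_n) (db dy : 'rV[R]_n).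
Hypothesis DA : forall i j, is_derive z v (fun x => A x i j) (dA i j).
Hypothesis Db : forall j, is_derive z v (fun x => b x 0 j) (db 0 j).
Hypothesis Dy : forall j, is_derive z v (fun x => y x 0 j) (dy 0 j).
Hypothesis Asym : forall i j, A z i j = A z j i.
Hypothesis q0 : 0 < quad (A z) (y z).

Let dlow i := low dA (y z) i + low (A z) dy i.
Let dlin := lin db (y z) + lin (b z) dy.
Let al := Num.sqrt (quad (A z) (y z)).
Let dal := (quad dA (y z) + 2 * lin (\row_i low (A z) (y z) i) dy) / (2 * al).

Let al0 : al != 0. Proof. by rewrite gt_eqF// sqrtr_gt0. Qed.

Lemma is_derive_low i : is_derive z v (fun x => low (A x) (y x) i) (dlow i).
Proof.
rewrite /dlow /low -big_split /=; apply: is_derive_big => j.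
exact: is_derive_mul.
Qed.

Lemma is_derive_lin : is_derive z v (fun x => lin (b x) (y x)) dlin.
Proof.
rewrite /dlin /lin -big_split /=; apply: is_derive_big => j.
exact: is_derive_mul.
Qed.

Lemma is_derive_quad : is_derive z v (fun x => quad (A x) (y x))
  (quad dA (y z) + 2 * lin (\row_i low (A z) (y z) i) dy).
Proof.
have : is_derive z v (fun x => quad (A x) (y x)) (\sum_i
  (dlow i * y z 0 i + low (A z) (y z) i * dy 0 i)).
  rewrite /quad /lin; apply: is_derive_big => i.
  under eq_fun do rewrite mxE.
  by apply: is_derive_mul; first exact: is_derive_low.
move=> H; apply: is_derive_eq H _; rewrite /dlow /quad /lin.
have E : \sum_i low (A z) dy i * y z 0 i = \sum_i low (A z) (y z) i * dy 0 i.
  rewrite /low; under eq_bigr do rewrite mulr_suml.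
  rewrite exchange_big /=; apply: eq_bigr => i _.
  by rewrite mulr_suml; apply: eq_bigr => j _; rewrite (Asym j i); ring.
under eq_bigr do rewrite mulrDl.
rewrite !big_split /= E -addrA -mulr2n mulr_natl; congr (_ + _ *+ 2).
  by apply: eq_bigr => i _; rewrite mxE.
by apply: eq_bigr => i _; rewrite mxE.
Qed.

Lemma is_derive_al : is_derive z v (fun x => Num.sqrt (quad (A x) (y x))) dal.
Proof. by apply: is_derive_sqrt_comp => //; exact: is_derive_quad. Qed.

Let is_derive_ial := is_derive_inv (f := fun x => Num.sqrt (quad (A x) (y x)))
  al0 is_derive_al.

Lemma is_derive_randers :
  is_derive z v (fun x => randers (A x) (b x) (y x)) (dal + dlin).
Proof. exact: is_derive_add is_derive_al is_derive_lin. Qed.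

Lemma is_derive_slope i : is_derive z v (fun x => slope (A x) (b x) (y x) i)
  (slope_var (A z) (y z) dal (dlow i) (db 0 i) i).
Proof.
have H := is_derive_add (is_derive_mul (is_derive_low i)
  is_derive_ial) (Db i).
apply: is_derive_eq H _; rewrite /slope_var -/al.
by move: al0; move: al dal (dlow i) (low _ _ _) => a da p1 p2 a0; field.
Qed.

Lemma is_derive_tensor i j :
  is_derive z v (fun x => randers_tensor (A x) (b x) (y x) i j)
    (tensor_var (A z) (b z) (y z) dal (dal + dlin) (dA i j)
       (dlow i) (dlow j) (db 0 i) (db 0 j) i j).
Proof.
have al30 : al ^+ 3 != 0 by rewrite expf_neq0.
have D3 : is_derive z v (fun x => Num.sqrt (quad (A x) (y x)) ^+ 3) (3 * al ^+ 2 * dal).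
  under eq_fun do rewrite !exprS expr0 mulr1.
  apply: is_derive_eq (is_derive_mul is_derive_al (is_derive_mul is_derive_al is_derive_al)) _.
  by rewrite -/al; ring.
have H := is_derive_add (is_derive_mul (is_derive_slope i) (is_derive_slope j))
 (is_derive_mul is_derive_randers
  (is_derive_sub (is_derive_mul (DA i j) is_derive_ial)
    (is_derive_mul (is_derive_mul (is_derive_low i) (is_derive_low j))
      (is_derive_inv (f := fun x => Num.sqrt (quad (A x) (y x)) ^+ 3) al30 D3)))).
apply: is_derive_eq H _; rewrite /tensor_var -/al.
move: (dlow i) (dlow j) (slope_var _ _ _ _ _ _) (slope_var _ _ _ _ _ _) => p1 p2 s1 s2.
by move: al0; move: al dal dlin (randers _ _ _) => a da dl r a0; field.
Qed.

End Variation.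

End RandersTensor.

Section RandersAlgebra.
Context {R : realType} {n : nat}.
Variables (A : 'M[R]_n) (b : 'rV[R]_n).
Hypothesis Asym : forall i j, A i j = A j i.
Hypothesis Apos : forall y, y != 0 -> 0 < quad A y.
Hypothesis Lpos : forall y, y != 0 -> 0 < randers A b y.
Implicit Types (y v : 'rV[R]_n).

Lemma randers_tensor_sym y i j : randers_tensor A b y i j = randers_tensor A b y j i.
Proof. by rewrite /randers_tensor (Asym i j); ring. Qed.

Lemma lin_lowC y v : lin (\row_i low A y i) v = lin (\row_i low A v i) y.
Proof.
rewrite /lin /low; under eq_bigr do rewrite mxE mulr_suml.
rewrite exchange_big /=; apply: eq_bigr => i _.
by rewrite mxE mulr_suml; apply: eq_bigr => j _; rewrite (Asym j i); ring.
Qed.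

Lemma linZr (c : 'rV[R]_n) k v : lin c (k *: v) = k * lin c v.
Proof. by rewrite /lin mulr_sumr; apply: eq_bigr => i _; rewrite mxE; ring. Qed.

Lemma quadB y v k :
  quad A (v - k *: y) =
  quad A v - 2 * k * lin (\row_i low A y i) v + k ^+ 2 * quad A y.
Proof.
have lowE i : low A (v - k *: y) i = low A v i - k * low A y i.
  by rewrite /low mulr_sumr -sumrB; apply: eq_bigr => j _; rewrite !mxE; ring.
rewrite {1}/quad {1}/lin.
transitivity (\sum_i (low A v i * v 0 i - k * (low A y i * v 0 i)
    - k * (low A v i * y 0 i) + k ^+ 2 * (low A y i * y 0 i))).
  by apply: eq_bigr => i _; rewrite !mxE lowE; ring.
rewrite !big_split /= !sumrN -!mulr_sumr.
have E (x z : 'rV[R]_n) : \sum_i low A x i * z 0 i = lin (\row_i low A x i) z.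
  by apply: eq_bigr => i _; rewrite mxE.
by rewrite !E (lin_lowC v y) -/(quad A v) -/(quad A y); ring.
Qed.

Section AtPoint.
Variables (y : 'rV[R]_n) (y0 : y != 0).
Let al := Num.sqrt (quad A y).
Let al0 : 0 < al. Proof. by rewrite sqrtr_gt0 Apos. Qed.
Let alN : al != 0. Proof. by rewrite gt_eqF. Qed.
Let alE : quad A y = al ^+ 2. Proof. by rewrite sqr_sqrtr// ltW// Apos. Qed.

(** Splitting off the square of the slope leaves L / alpha times the part of v
    that is A-orthogonal to y. *)
Lemma tensor_quad v :
  \sum_i v 0 i * (\sum_j randers_tensor A b y i j * v 0 j) =
  (\sum_i slope A b y i * v 0 i) ^+ 2 +
  randers A b y / al * (quad A v - (lin (\row_i low A y i) v) ^+ 2 / al ^+ 2).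
Proof.
set S := \sum_i slope A b y i * v 0 i.
have E i : \sum_j randers_tensor A b y i j * v 0 j =
  slope A b y i * S + randers A b y *
   (low A v i / al - low A y i * lin (\row_j low A y j) v / al ^+ 3).
  transitivity (\sum_j (slope A b y i * (slope A b y j * v 0 j) +
    (randers A b y / al * (A i j * v 0 j) -
      randers A b y * low A y i / al ^+ 3 * ((\row_j low A y j) 0 j * v 0 j)))).
    by apply: eq_bigr => j _; rewrite /randers_tensor -/al mxE; field.
  rewrite big_split sumrB /= -!mulr_sumr -/S /lin -/(low A v i).
  by ring.
under eq_bigr do rewrite E.
have -> : S ^+ 2 = \sum_i v 0 i * (slope A b y i * S).
  by rewrite expr2 {1}/S mulr_suml; apply: eq_bigr => i _; ring.
have -> : randers A b y / al * (quad A v - lin (\row_j low A y j) v ^+ 2 / al ^+ 2)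
  = \sum_i (v 0 i * (randers A b y * (low A v i / al
     - low A y i * lin (\row_j low A y j) v / al ^+ 3))).
  transitivity (randers A b y / al * (\sum_i (\row_i low A v i) 0 i * v 0 i) -
     randers A b y * lin (\row_j low A y j) v / al ^+ 3
       * (\sum_i (\row_i low A y i) 0 i * v 0 i)).
    rewrite -/(lin (\row_i low A v i) v) -/(lin (\row_i low A y i) v) -/(quad A v).
    by field.
  by rewrite [X in X - _]mulr_sumr [X in _ - X]mulr_sumr -sumrB; apply: eq_bigr => i _;
    rewrite !mxE; field.
by rewrite -big_split; apply: eq_bigr => i _ /=; ring.
Qed.

Lemma slope_lin v : \sum_i slope A b y i * v 0 i =
  lin (\row_i low A y i) v / al + lin b v.
Proof.
rewrite /slope /lin mulr_suml -big_split; apply: eq_bigr => i _ /=.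
by rewrite mxE -/al; ring.
Qed.

Lemma slope_radial : \sum_i slope A b y i * y 0 i = randers A b y.
Proof. by rewrite slope_lin -/(quad A y) alE expr2 mulfK. Qed.

Lemma tensor_radial j :
  \sum_i y 0 i * randers_tensor A b y i j = randers A b y * slope A b y j.
Proof.
transitivity (\sum_i (slope A b y j * (slope A b y i * y 0 i) +
  (randers A b y / al * (A j i * y 0 i)
   - randers A b y * low A y j / al ^+ 3 * ((\row_i low A y i) 0 i * y 0 i)))).
  by apply: eq_bigr => i _; rewrite /randers_tensor -/al mxE (Asym i j); field.
rewrite big_split sumrB /= -!mulr_sumr slope_radial -/(low A y j) -/(lin _ y) -/(quad A y) alE.
by field.
Qed.

(** A vector v in the kernel makes both terms of [tensor_quad] vanish; so v is a
    multiple t y of y, and then the slope gives t L = 0. *)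
Lemma randers_tensor_unit :
  (\matrix_(i, j) randers_tensor A b y i j) \in unitmx.
Proof.
rewrite -row_free_unit -kermx_eq0; apply/rowV0P => v /sub_kermxP vG.
have : \sum_i v 0 i * (\sum_j randers_tensor A b y i j * v 0 j) = 0.
  transitivity (\sum_j (v *m \matrix_(i, j) randers_tensor A b y i j) 0 j * v 0 j).
    under eq_bigr do rewrite mulr_sumr.
    rewrite exchange_big /=; apply: eq_bigr => j _.
    by rewrite mxE mulr_suml; apply: eq_bigr => i _; rewrite mxE; ring.
  by rewrite vG big1// => j _; rewrite mxE mul0r.
rewrite tensor_quad slope_lin.
set p := lin (\row_i low A y i) v; pose w := v - (p / al ^+ 2) *: y.
have -> : quad A v - p ^+ 2 / al ^+ 2 = quad A w.
  by rewrite quadB -/p alE; field.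
have Lal : 0 < randers A b y / al by rewrite divr_gt0// Lpos.
have [wz|wz H] := eqVneq w 0; last first.
  have H1 := sqr_ge0 (p / al + lin b v).
  by have := ltr_wpDl H1 (mulr_gt0 Lal (Apos wz)); rewrite H ltxx.
rewrite wz; have -> : quad A 0 = 0 by rewrite /quad lin0r.
have vE : v = (p / al ^+ 2) *: y by apply/eqP; rewrite -subr_eq0; exact/eqP.
have -> : p / al + lin b v = p / al ^+ 2 * randers A b y.
  by rewrite vE linZr /randers -/al; field.
move/eqP; rewrite mulr0 addr0 sqrf_eq0 mulf_eq0 (gt_eqF (Lpos y0)) orbF => /eqP t0.
by rewrite vE t0 scale0r.
Qed.

(** Euler's relation y^s dg_sj/dy^l = 0, in closed form. *)
Lemma tensor_var_radial l j :
  \sum_s y 0 s * tensor_var A b y (low A y l / al) (slope A b y l)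
     0 (A s l) (A j l) 0 0 s j = 0.
Proof.
transitivity (\sum_s (
  (slope_var A y (low A y l / al) (A j l) 0 j * (slope A b y s * y 0 s)
  + slope A b y l / al * (A j s * y 0 s)
  + (A s l * y 0 s) * (slope A b y j / al - randers A b y * low A y j / al ^+ 3)
  + ((\row_i low A y i) 0 s * y 0 s) * (
    - low A y l / al ^+ 3 * slope A b y j - slope A b y l * low A y j / al ^+ 3
    - randers A b y * A j l / al ^+ 3
    + randers A b y * low A y j * (3 * low A y l / al) / al ^+ 4)
  - randers A b y * low A y l / al ^+ 3 * (A j s * y 0 s)))).
  apply: eq_bigr => s _; rewrite mxE /tensor_var {1}/slope_var -/al (Asym s j).
  by field.
rewrite sumrB !big_split /= -!mulr_sumr -!mulr_suml slope_radial -/(low A y j).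
rewrite -/(lin _ y) -/(quad A y) alE.
have -> : \sum_i A i l * y 0 i = low A y l.
  by apply: eq_bigr => i _; rewrite (Asym i l).
by rewrite /slope_var /slope -/al; field.
Qed.

Lemma tensor_var_sym dal dL daij dpi dpj dbi dbj i j :
  tensor_var A b y dal dL daij dpi dpj dbi dbj i j =
  tensor_var A b y dal dL daij dpj dpi dbj dbi j i.
Proof. by rewrite /tensor_var (Asym i j); ring. Qed.

End AtPoint.
End RandersAlgebra.

(** * Horizontally constant Randers tensors *)
Section RandersVariationAlgebra.
Context {R : realType} {n : nat}.
Variables (A : 'M[R]_n) (b : 'rV[R]_n).
Hypothesis Asym : forall i j, A i j = A j i.
Hypothesis Apos : forall y, y != 0 -> 0 < quad A y.
Hypothesis Lpos : forall y, y != 0 -> 0 < randers A b y.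

Lemma sym_quad_eq0 (S : 'M[R]_n) : (forall i j, S i j = S j i) ->
  (forall y, quad S y = 0) -> S = 0.
Proof.
move=> Ssym S0; apply/matrixP => i j; rewrite mxE.
have := S0 (delta_mx 0 i - (-1) *: delta_mx 0 j).
rewrite quadB// !S0 lin_delta mxE low_delta; lra.
Qed.

Definition tensor_dx y (dA : 'M[R]_n) (db : 'rV[R]_n) i j : R :=
  let dal := quad dA y / (2 * Num.sqrt (quad A y)) in
  tensor_var A b y dal (dal + lin db y) (dA i j) (low dA y i) (low dA y j)
    (db 0 i) (db 0 j) i j.

Definition tensor_dy y l i j : R :=
  tensor_var A b y (low A y l / Num.sqrt (quad A y)) (slope A b y l)
    0 (A i l) (A j l) 0 0 i j.

Section AtPoint.
Variables (y : 'rV[R]_n) (y0 : y != 0).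
Let al := Num.sqrt (quad A y).
Let al0 : 0 < al. Proof. by rewrite sqrtr_gt0 Apos. Qed.
Let alN : al != 0. Proof. by rewrite gt_eqF. Qed.
Let alE : quad A y = al ^+ 2. Proof. by rewrite sqr_sqrtr// ltW// Apos. Qed.

Lemma tensor_dx_sym (dA : 'M[R]_n) db i j : (forall i j, dA i j = dA j i) ->
  tensor_dx y dA db i j = tensor_dx y dA db j i.
Proof. by move=> dAsym; rewrite /tensor_dx tensor_var_sym// (dAsym i j). Qed.

Lemma tensor_dy_sym l i j : tensor_dy y l i j = tensor_dy y l j i.
Proof. by rewrite /tensor_dy tensor_var_sym. Qed.

Lemma tensor_dy_radial l j : \sum_s y 0 s * tensor_dy y l s j = 0.
Proof. exact: tensor_var_radial. Qed.

(** As g_ij y^i y^j = L^2, contracting dg/dx twice with y gives 2 L dL/dx. *)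
Lemma tensor_dx_radial2 dA db :
  \sum_j (\sum_i y 0 i * tensor_dx y dA db i j) * y 0 j =
  2 * randers A b y * (quad dA y / (2 * al) + lin db y).
Proof.
rewrite /tensor_dx -/al.
have q2 : quad dA y = 2 * al * (quad dA y / (2 * al)) by field.
set dal := quad dA y / (2 * al) in q2 *; set dL := dal + _.
have lowE (B : 'M[R]_n) : \sum_i low B y i * y 0 i = quad B y.
  by apply: eq_bigr => i _; rewrite mxE.
have rowE (B : 'M[R]_n) j : \sum_i y 0 i * B j i = low B y j.
  by apply: eq_bigr => i _; rewrite mulrC.
have svE : \sum_i slope_var A y dal (low dA y i) (db 0 i) i * y 0 i = dal + lin db y.
  transitivity (\sum_i (low dA y i * y 0 i / al - dal / al ^+ 2 * (low A y i * y 0 i)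
     + db 0 i * y 0 i)).
    by apply: eq_bigr => i _; rewrite /slope_var -/al; field.
  rewrite big_split sumrB /= -mulr_suml -mulr_sumr !lowE -/(lin db y) alE q2.
  by field.
transitivity (\sum_j \sum_i (
   (slope_var A y dal (low dA y i) (db 0 i) i * y 0 i) * (slope A b y j * y 0 j)
   + (slope A b y i * y 0 i) * (slope_var A y dal (low dA y j) (db 0 j) j * y 0 j)
   + (dL / al - randers A b y * dal / al ^+ 2) * (A i j * y 0 i * y 0 j)
   + (randers A b y * (3 * dal) / al ^+ 4 - dL / al ^+ 3) *
       ((low A y i * y 0 i) * (low A y j * y 0 j))
   + randers A b y / al * (dA i j * y 0 i * y 0 j)
   - randers A b y / al ^+ 3 * ((low dA y i * y 0 i) * (low A y j * y 0 j))
   - randers A b y / al ^+ 3 * ((low A y i * y 0 i) * (low dA y j * y 0 j)))).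
  apply: eq_bigr => j _; rewrite mulr_suml; apply: eq_bigr => i _.
  by rewrite /tensor_var -/al; field.
have prodE (f h : 'I_n -> R) : \sum_j \sum_i f i * h j = (\sum_i f i) * (\sum_j h j).
  by rewrite mulr_sumr; apply: eq_bigr => j _; rewrite mulr_suml.
have quadE (B : 'M[R]_n) : \sum_j \sum_i B i j * y 0 i * y 0 j = quad B y.
  rewrite exchange_big /=; apply: eq_bigr => i _.
  by rewrite mxE mulr_suml; apply: eq_bigr => j _; ring.
have cE (c : R) (f : 'I_n -> 'I_n -> R) : \sum_j \sum_i c * f i j = c * \sum_j \sum_i f i j.
  by rewrite mulr_sumr; apply: eq_bigr => j _; rewrite mulr_sumr.
under eq_bigr do rewrite !(sumrB, big_split) /=.
rewrite !(sumrB, big_split) /= !(sumrN, cE).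
rewrite !prodE !quadE svE slope_radial// !lowE alE q2 /dL.
by field.
Qed.

(** The variation is linear in the variations of its ingredients, hence the
    horizontal derivative is the variation for horizontal ingredients. *)
Lemma tensor_var_lincomb (c : 'I_n -> R) dal dL daij dpi dpj dbi dbj
    (al' L' pi' pj' : 'I_n -> R) i j :
  tensor_var A b y dal dL daij dpi dpj dbi dbj i j
  - \sum_l c l * tensor_var A b y (al' l) (L' l) 0 (pi' l) (pj' l) 0 0 i j =
  tensor_var A b y (dal - \sum_l c l * al' l) (dL - \sum_l c l * L' l) daij
    (dpi - \sum_l c l * pi' l) (dpj - \sum_l c l * pj' l) dbi dbj i j.
Proof.
set Sa := \sum_l c l * al' l; set SL := \sum_l c l * L' l.
set Si := \sum_l c l * pi' l; set Sj := \sum_l c l * pj' l.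
pose T x1 x2 x3 x4 := tensor_var A b y x1 x2 0 x3 x4 0 0 i j.
have TD k x1 x2 x3 x4 z1 z2 z3 z4 : T (x1 + k * z1) (x2 + k * z2) (x3 + k * z3)
    (x4 + k * z4) = T x1 x2 x3 x4 + k * T z1 z2 z3 z4.
  by rewrite /T /tensor_var /slope_var; ring.
have -> : \sum_l c l * tensor_var A b y (al' l) (L' l) 0 (pi' l) (pj' l) 0 0 i j
    = T Sa SL Si Sj.
  rewrite /Sa /SL /Si /Sj.
  elim: (index_enum _) => [|l s IH].
    by rewrite !big_nil /T /tensor_var /slope_var; ring.
  rewrite !big_cons IH -/(T _ _ _ _) addrC -TD.
  by congr T; rewrite addrC.
by rewrite /T /tensor_var /slope_var; ring.
Qed.

(** If A and b are parallel, then along a horizontal direction alpha and beta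
    are constant, and A, b and A y transform by Ga; so does every tensor
    built from them. *)
Lemma tensor_parallel (Ga : 'I_n -> 'I_n -> R) (M : 'I_n -> R)
    (dA : 'M[R]_n) (db : 'rV[R]_n) :
  (forall l, M l = \sum_r Ga l r * y 0 r) ->
  (forall i j, dA i j = \sum_l Ga l i * A l j + \sum_l Ga l j * A l i) ->
  (forall i, db 0 i = \sum_l Ga l i * b 0 l) ->
  forall i j, tensor_dx y dA db i j - \sum_l M l * tensor_dy y l i j =
    \sum_l Ga l i * randers_tensor A b y l j
    + \sum_l Ga l j * randers_tensor A b y l i.
Proof.
move=> ME dAE dbE i j.
have GaA k : \sum_l Ga l k * low A y l = \sum_j (\sum_l Ga l k * A l j) * y 0 j.
  under [RHS]eq_bigr do rewrite mulr_suml.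
  rewrite exchange_big /=; apply: eq_bigr => l _.
  by rewrite /low mulr_sumr; apply: eq_bigr => m _; ring.
have MAE k : \sum_l M l * A k l = \sum_j (\sum_l Ga l j * A l k) * y 0 j.
  under [RHS]eq_bigr do rewrite mulr_suml.
  rewrite exchange_big /=; apply: eq_bigr => l _; rewrite ME mulr_suml.
  by apply: eq_bigr => m _; rewrite (Asym k l); ring.
have dpE k : low dA y k - \sum_l M l * A k l = \sum_l Ga l k * low A y l.
  rewrite GaA MAE /low -sumrB; apply: eq_bigr => m _.
  by rewrite dAE; ring.
have qE : quad dA y = 2 * \sum_l M l * low A y l.
  have E1 : \sum_k (\sum_l Ga l k * low A y l) * y 0 k = \sum_l M l * low A y l.
    under eq_bigr do rewrite mulr_suml.
    rewrite exchange_big /=; apply: eq_bigr => l _; rewrite ME mulr_suml.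
    by apply: eq_bigr => m _; ring.
  have E2 : \sum_k (\sum_l M l * A k l) * y 0 k = \sum_l M l * low A y l.
    under eq_bigr do rewrite mulr_suml.
    rewrite exchange_big /=; apply: eq_bigr => l _; rewrite /low mulr_sumr.
    by apply: eq_bigr => m _; rewrite (Asym m l); ring.
  rewrite mulrDl mul1r -{1}E1 -E2 -big_split; apply: eq_bigr => k _ /=.
  by rewrite mxE -dpE; ring.
have lE : lin db y = \sum_l M l * b 0 l.
  rewrite /lin; under eq_bigr do rewrite dbE mulr_suml.
  rewrite exchange_big /=; apply: eq_bigr => l _; rewrite ME mulr_suml.
  by apply: eq_bigr => m _; ring.
rewrite /tensor_dx /tensor_dy -/al tensor_var_lincomb.
have alE0 : quad dA y / (2 * al) - \sum_l M l * (low A y l / al) = 0.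
  rewrite qE; under [X in _ - X]eq_bigr do rewrite mulrA.
  by rewrite -mulr_suml; field.
have LE0 : quad dA y / (2 * al) + lin db y - \sum_l M l * slope A b y l = 0.
  under eq_bigr do rewrite /slope -/al mulrDr.
  by rewrite big_split /= opprD addrACA alE0 lE subrr addr0.
rewrite alE0 LE0 !dpE dAE !dbE.
have svE k : slope_var A y 0 (\sum_l Ga l k * low A y l) (\sum_l Ga l k * b 0 l) k
    = \sum_l Ga l k * slope A b y l.
  rewrite /slope_var /slope -/al; under [RHS]eq_bigr do rewrite mulrDr mulrA.
  by rewrite big_split /= -mulr_suml; ring.
rewrite /tensor_var !svE -/al.
have tE k m : \sum_l Ga l k * randers_tensor A b y l m =
  (\sum_l Ga l k * slope A b y l) * slope A b y m +
  randers A b y * ((\sum_l Ga l k * A l m) / al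
     - (\sum_l Ga l k * low A y l) * low A y m / al ^+ 3).
  rewrite !mulr_suml -sumrB mulr_sumr -big_split; apply: eq_bigr => l _ /=.
  by rewrite /randers_tensor -/al; field.
by rewrite !tE; field.
Qed.

(** Contracting the compatibility equation twice with y produces a factor 2 L on
    both sides; dividing by it, alpha + beta is constant along the horizontal
    direction M. *)
Lemma parallel_contract (Ga : 'I_n -> 'I_n -> R) (M : 'I_n -> R)
    (dA : 'M[R]_n) (db : 'rV[R]_n) :
  (forall l, M l = \sum_r Ga l r * y 0 r) ->
  (forall i j, tensor_dx y dA db i j - \sum_l M l * tensor_dy y l i j =
    \sum_l Ga l i * randers_tensor A b y l j
    + \sum_l Ga l j * randers_tensor A b y l i) ->
  quad dA y / (2 * al) + lin db y =
  (\sum_l M l * low A y l) / al + \sum_l M l * b 0 l.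
Proof.
move=> ME H.
have T1 : \sum_j (\sum_i y 0 i * (tensor_dx y dA db i j
   - \sum_l M l * tensor_dy y l i j)) * y 0 j =
   2 * randers A b y * (quad dA y / (2 * al) + lin db y).
  rewrite -tensor_dx_radial2; apply: eq_bigr => j _; congr (_ * _).
  under eq_bigr do rewrite mulrBr.
  rewrite sumrB [X in _ - X](_ : _ = 0) ?subr0//.
  under eq_bigr do rewrite mulr_sumr.
  rewrite exchange_big /=; apply: big1 => l _.
  transitivity (M l * \sum_i y 0 i * tensor_dy y l i j).
    by rewrite mulr_sumr; apply: eq_bigr => i _; ring.
  by rewrite tensor_dy_radial mulr0.
have T2 : \sum_j (\sum_i y 0 i * (\sum_l Ga l i * randers_tensor A b y l j)) * y 0 j
   = randers A b y * \sum_l M l * slope A b y l.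
  have E j : \sum_i y 0 i * (\sum_l Ga l i * randers_tensor A b y l j) =
      \sum_l M l * randers_tensor A b y l j.
    under eq_bigr do rewrite mulr_sumr.
    rewrite exchange_big /=; apply: eq_bigr => l _; rewrite ME mulr_suml.
    by apply: eq_bigr => m _; ring.
  under eq_bigr do rewrite E mulr_suml.
  rewrite exchange_big /= mulr_sumr; apply: eq_bigr => l _.
  transitivity (M l * \sum_j y 0 j * randers_tensor A b y j l).
    rewrite mulr_sumr; apply: eq_bigr => j _.
    by rewrite (randers_tensor_sym b Asym y l j); ring.
  by rewrite tensor_radial//; ring.
have T3 : \sum_j (\sum_i y 0 i * (\sum_l Ga l j * randers_tensor A b y l i)) * y 0 j
   = randers A b y * \sum_l M l * slope A b y l.
  rewrite -T2; under eq_bigr do rewrite mulr_suml.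
  rewrite exchange_big /=; apply: eq_bigr => i _; rewrite mulr_suml.
  by apply: eq_bigr => j _; ring.
have : 2 * randers A b y * (quad dA y / (2 * al) + lin db y) =
    2 * randers A b y * \sum_l M l * slope A b y l.
  rewrite -T1.
  transitivity (\sum_j ((\sum_i y 0 i * (\sum_l Ga l i * randers_tensor A b y l j)) * y 0 j
     + (\sum_i y 0 i * (\sum_l Ga l j * randers_tensor A b y l i)) * y 0 j)).
    apply: eq_bigr => j _; rewrite -mulrDl -big_split; congr (_ * _).
    by apply: eq_bigr => i _ /=; rewrite H mulrDr.
  by rewrite big_split /= T2 T3; ring.
have LN : 2 * randers A b y != 0 by rewrite mulf_neq0// gt_eqF// Lpos.
move=> /(mulfI LN) ->; under eq_bigr do rewrite /slope -/al mulrDr mulrA.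
by rewrite big_split /= -mulr_suml.
Qed.

End AtPoint.

(** Replacing y by - y in [parallel_contract] separates alpha from beta, since M
    is odd in y; the two resulting identities in y are then polarized. *)
Lemma parallel_of_tensor (Ga : 'I_n -> 'I_n -> R)
    (dA : 'M[R]_n) (db : 'rV[R]_n) :
  (forall i j, dA i j = dA j i) ->
  (forall y, y != 0 -> forall i j,
    tensor_dx y dA db i j - \sum_l (\sum_r Ga l r * y 0 r) * tensor_dy y l i j =
    \sum_l Ga l i * randers_tensor A b y l j
    + \sum_l Ga l j * randers_tensor A b y l i) ->
  (forall i j, dA i j = \sum_l Ga l i * A l j + \sum_l Ga l j * A l i) /\
  (forall i, db 0 i = \sum_l Ga l i * b 0 l).
Proof.
move=> dAsym H.
pose M (y : 'rV[R]_n) l := \sum_r Ga l r * y 0 r.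
have lowN (B : 'M[R]_n) y i : low B (- y) i = - low B y i.
  by rewrite /low -sumrN; apply: eq_bigr => j _; rewrite mxE; ring.
have quadN (B : 'M[R]_n) y : quad B (- y) = quad B y.
  by apply: eq_bigr => j _; rewrite !mxE lowN; ring.
have linN (c y : 'rV[R]_n) : lin c (- y) = - lin c y.
  by rewrite /lin -sumrN; apply: eq_bigr => j _; rewrite mxE; ring.
have MN y l : M (- y) l = - M y l.
  by rewrite /M -sumrN; apply: eq_bigr => j _; rewrite mxE; ring.
have C (y : 'rV[R]_n) : y != 0 -> quad dA y = 2 * \sum_l M y l * low A y l /\
    lin db y = \sum_l M y l * b 0 l.
  move=> y0; have yN0 : - y != 0 by rewrite oppr_eq0.
  have al0 : Num.sqrt (quad A y) != 0 by rewrite gt_eqF// sqrtr_gt0 Apos.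
  have E1 := parallel_contract y0 (fun l => erefl (M y l)) (H y y0).
  have := parallel_contract yN0 (fun l => erefl (M (- y) l)) (H _ yN0).
  rewrite !quadN linN.
  have -> : \sum_l M (- y) l * low A (- y) l = \sum_l M y l * low A y l.
    by apply: eq_bigr => l _; rewrite MN lowN; ring.
  have -> : \sum_l M (- y) l * b 0 l = - \sum_l M y l * b 0 l.
    by rewrite -sumrN; apply: eq_bigr => l _; rewrite MN; ring.
  move=> E2; split; last by lra.
  have E3 : quad dA y / (2 * Num.sqrt (quad A y)) =
    (\sum_l M y l * low A y l) / Num.sqrt (quad A y) by lra.
  transitivity (2 * Num.sqrt (quad A y) * (quad dA y / (2 * Num.sqrt (quad A y)))).
    by field.
  by rewrite E3; field.
split=> [i j|i]; last first.
  have d0 : delta_mx 0 i != 0 :> 'rV[R]_n.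
    apply/eqP => /matrixP /(_ 0 i); rewrite !mxE !eqxx; exact/eqP/oner_neq0.
  have [_] := C _ d0; rewrite lin_delta => ->; apply: eq_bigr => l _; congr (_ * _).
  rewrite /M (bigD1 i)//= mxE !eqxx mulr1 big1 ?addr0// => k ki.
  by rewrite mxE (negPf ki) andbF mulr0.
pose S : 'M[R]_n := \matrix_(i, j)
  (dA i j - (\sum_l Ga l i * A l j + \sum_l Ga l j * A l i)).
suff /matrixP /(_ i j) : S = 0 by rewrite !mxE => /eqP; rewrite subr_eq0 => /eqP.
apply: sym_quad_eq0 => [a c|y]; first by rewrite !mxE dAsym [X in _ - X]addrC.
have [->|y0] := eqVneq y 0; first by rewrite /quad lin0r.
have [qE _] := C _ y0.
have E1 : \sum_k (\sum_m (\sum_l Ga l k * A l m) * y 0 m) * y 0 k =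
    \sum_l M y l * low A y l.
  have E k : \sum_m (\sum_l Ga l k * A l m) * y 0 m = \sum_l Ga l k * low A y l.
    under eq_bigr do rewrite mulr_suml.
    rewrite exchange_big /=; apply: eq_bigr => l _; rewrite /low mulr_sumr.
    by apply: eq_bigr => m _; ring.
  under eq_bigr do rewrite E mulr_suml.
  rewrite exchange_big /=; apply: eq_bigr => l _; rewrite /M mulr_suml.
  by apply: eq_bigr => m _; ring.
have E2 : \sum_k (\sum_m (\sum_l Ga l m * A l k) * y 0 m) * y 0 k =
    \sum_l M y l * low A y l.
  rewrite -E1; under eq_bigr do rewrite mulr_suml.
  rewrite exchange_big /=; apply: eq_bigr => k _; rewrite mulr_suml.
  by apply: eq_bigr => m _; ring.
transitivity (quad dA y - (\sum_k (\sum_m (\sum_l Ga l k * A l m) * y 0 m) * y 0 k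
   + \sum_k (\sum_m (\sum_l Ga l m * A l k) * y 0 m) * y 0 k)).
  rewrite -big_split -sumrB; apply: eq_bigr => k _ /=.
  rewrite !mxE -mulrDl -mulrBl -big_split /low -sumrB; congr (_ * _).
  by apply: eq_bigr => m _ /=; rewrite mxE; ring.
by rewrite E1 E2 qE; ring.
Qed.

End RandersVariationAlgebra.

(** * Berwald type in a chart: the form is parallel *)
Section RandersChart.
Context {R : realType} {n : nat}.
Local Notation vec := 'rV[R]_n.
Variables (U : set vec) (L : vec -> vec -> R).
Variables (A : vec -> 'M[R]_n) (b : vec -> vec).
Hypothesis openU : open U.
Hypothesis LE : forall u, U u -> forall y, L u y = randers (A u) (b u) y.
Hypothesis Asym : forall u, U u -> forall i j, A u i j = A u j i.
Hypothesis Apos : forall u, U u -> forall y, y != 0 -> 0 < quad (A u) y.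
Hypothesis Lpos : forall u, U u -> forall y, y != 0 -> 0 < randers (A u) (b u) y.
Hypothesis Adiff : forall u, U u -> forall i j, differentiable (fun u => A u i j) u.
Hypothesis bdiff : forall u, U u -> forall i, differentiable (fun u => b u 0 i) u.

Definition dmetric u k : 'M[R]_n :=
  \matrix_(i, j) 'D_(delta_mx 0 k) (fun u => A u i j) u.
Definition dform u k : vec := \row_i 'D_(delta_mx 0 k) (fun u => b u 0 i) u.

Definition parallel u (Ga : 'I_n -> 'I_n -> 'I_n -> R) : Prop :=
  [/\ forall i j k, Ga i j k = Ga i k j,
      metric_compatible (A u) (fun k i j => dmetric u k i j) Ga &
      forall k i, dform u k 0 i = \sum_l Ga l k i * b u 0 l].

Lemma is_derive_coord (y v : vec) i : is_derive y v (fun y => y 0 i) (v 0 i).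
Proof.
have := @is_derive_id R vec y v => -[d D].
have dd : differentiable (fun y : vec => y 0 i) y by exact: differentiable_coord.
split; first exact: diff_derivable.
by rewrite (derive_entry v 0 i (g := id))// D.
Qed.

Lemma nonzero_near (y : vec) : y != 0 -> \forall z \near y, z != 0.
Proof. by move=> y0; exact: (@cvgr_neq0 _ _ _ (nbhs y) _ id y (@cvg_id _ _) y0). Qed.

Let cst0 (c : 'M[R]_n) (y v : vec) i j :
  is_derive y v (fun=> c i j) ((0 : 'M[R]_n) i j).
Proof. by rewrite mxE; exact: is_derive_cst. Qed.

Let cst0r (c : vec) (y v : vec) j :
  is_derive y v (fun=> c 0 j) ((0 : vec) 0 j).
Proof. by rewrite mxE; exact: is_derive_cst. Qed.

Lemma nearU u : U u -> \forall z \near u, U z.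
Proof. by move=> uU; exact: (open_nbhs_nbhs (conj openU uU)). Qed.

Lemma dmetric_sym u k : U u -> forall i j, dmetric u k i j = dmetric u k j i.
Proof.
move=> uU i j; rewrite !mxE; apply: near_eq_derive.
by near=> z; apply: Asym; near: z; exact: nearU.
Unshelve. all: by end_near. Qed.

Section AtPoint.
Variable u : vec.
Hypothesis uU : U u.

Lemma partial_y_square i y : y != 0 ->
  partial_y (fun u' y' => L u' y' ^+ 2) i u y =
  2 * randers (A u) (b u) y * slope (A u) (b u) y i.
Proof.
move=> y0; rewrite /partial_y.
have -> : (fun y' => L u y' ^+ 2) =
    fun y' => randers (A u) (b u) y' * randers (A u) (b u) y'.
  by apply/funext => y'; rewrite LE// expr2.
have D := is_derive_randers (cst0 (A u) y (delta_mx 0 i))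
  (cst0r (b u) y (delta_mx 0 i)) (is_derive_coord y (delta_mx 0 i))
  (Asym uU) (Apos uU y0).
rewrite (is_derive_val (is_derive_mul D D)) quad0l lin0l lin_delta lin_delta mxE.
rewrite /slope; field.
by rewrite gt_eqF// sqrtr_gt0 Apos.
Qed.

Lemma fundamental_randers i j y : y != 0 ->
  fundamental L i j u y = randers_tensor (A u) (b u) y i j.
Proof.
move=> y0; rewrite /fundamental /partial_y.
have E : \forall z \near y, partial_y (fun u' y' => L u' y' ^+ 2) i u z =
    2 * randers (A u) (b u) z * slope (A u) (b u) z i.
  by apply: filterS (nonzero_near y0) => z; exact: partial_y_square.
rewrite (near_eq_derive _ E).
have D := is_derive_randers (cst0 (A u) y (delta_mx 0 j))
  (cst0r (b u) y (delta_mx 0 j)) (is_derive_coord y (delta_mx 0 j))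
  (Asym uU) (Apos uU y0).
have D' := is_derive_slope (cst0 (A u) y (delta_mx 0 j))
  (cst0r (b u) y (delta_mx 0 j)) (is_derive_coord y (delta_mx 0 j))
  (Asym uU) (Apos uU y0) i.
have D2 := is_derive_mul (is_derive_cst (2 : R) y (delta_mx 0 j)) D.
rewrite (is_derive_val (is_derive_mul D2 D')).
rewrite quad0l lin0l !low0l lin_delta lin_delta low_delta !mxE.
rewrite /slope_var /randers_tensor /slope; field.
by rewrite gt_eqF// sqrtr_gt0 Apos.
Qed.

Lemma partial_y_fundamental l i j y : y != 0 ->
  partial_y (fundamental L i j) l u y = tensor_dy (A u) (b u) y l i j.
Proof.
move=> y0; rewrite /partial_y.
have E : \forall z \near y, fundamental L i j u z = randers_tensor (A u) (b u) z i j.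
  by apply: filterS (nonzero_near y0) => z; exact: fundamental_randers.
rewrite (near_eq_derive _ E).
have D := is_derive_tensor (cst0 (A u) y (delta_mx 0 l))
  (cst0r (b u) y (delta_mx 0 l)) (is_derive_coord y (delta_mx 0 l))
  (Asym uU) (Apos uU y0) i j.
rewrite (is_derive_val D) quad0l lin0l !low0l !lin_delta !low_delta !mxE.
rewrite /tensor_dy !add0r.
have -> : 2 * low (A u) y l / (2 * Num.sqrt (quad (A u) y)) =
    low (A u) y l / Num.sqrt (quad (A u) y).
  by field; rewrite gt_eqF// sqrtr_gt0 Apos.
by [].
Qed.

End AtPoint.

Lemma partial_x_fundamental u k i j y : U u -> y != 0 ->
  partial_x (fundamental L i j) k u y =
  tensor_dx (A u) (b u) y (dmetric u k) (dform u k) i j.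
Proof.
move=> uU y0; rewrite /partial_x.
have E : \forall z \near u, fundamental L i j z y = randers_tensor (A z) (b z) y i j.
  near=> z; apply: fundamental_randers => //; near: z; exact: nearU.
rewrite (near_eq_derive _ E).
have DA i' j' : is_derive u (delta_mx 0 k : vec) (fun u => A u i' j') (dmetric u k i' j').
  by rewrite mxE; apply: derivableP; apply: diff_derivable; exact: Adiff.
have Db j' : is_derive u (delta_mx 0 k : vec) (fun u => b u 0 j') (dform u k 0 j').
  by rewrite mxE; apply: derivableP; apply: diff_derivable; exact: bdiff.
have D := is_derive_tensor (y := fun=> y) DA Db (cst0r y u (delta_mx 0 k))
  (Asym uU) (Apos uU y0) i j.
rewrite (is_derive_val D) !low0r !lin0r mulr0 !addr0.
by [].
Unshelve. all: by end_near. Qed.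

Lemma chern_randers u i j k y : U u -> y != 0 -> chern_coefficient L i j k u y =
  chern_symbol (\matrix_(i, j) randers_tensor (A u) (b u) y i j)
    (fun k i j => tensor_dx (A u) (b u) y (dmetric u k) (dform u k) i j)
    (tensor_dy (A u) (b u) y) y i j k.
Proof.
move=> uU y0.
transitivity (chern_symbol (\matrix_(i, j) fundamental L i j u y)
  (fun k i j => partial_x (fundamental L i j) k u y)
  (fun l i j => partial_y (fundamental L i j) l u y) y i j k); first by [].
congr (chern_symbol _ _ _ y i j k).
- by apply/matrixP => i' j'; rewrite !mxE fundamental_randers.
- by apply/funext => k'; apply/funext => i'; apply/funext => j';
    exact: partial_x_fundamental.
- by apply/funext => k'; apply/funext => i'; apply/funext => j';
    exact: partial_y_fundamental.
Qed.

Definition tensor_equation u y (Ga : 'I_n -> 'I_n -> 'I_n -> R) : Prop :=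
  forall k i j,
    tensor_dx (A u) (b u) y (dmetric u k) (dform u k) i j
    - \sum_l (\sum_r Ga l k r * y 0 r) * tensor_dy (A u) (b u) y l i j =
    \sum_l Ga l k i * randers_tensor (A u) (b u) y l j
    + \sum_l Ga l k j * randers_tensor (A u) (b u) y l i.

(** Expresses the characterization of the Chern coefficients through A, b and
    their derivatives, where it can be compared with parallelism of b. *)
Lemma chern_randersP u y (uU : U u) (y0 : y != 0) :
  let chern i j k := chern_coefficient L i j k u y in
  [/\ forall i j k, chern i j k = chern i k j, tensor_equation u y chern &
      forall Ga, (forall i j k, Ga i j k = Ga i k j) -> tensor_equation u y Ga ->
        forall i j k, chern i j k = Ga i j k].
Proof.
move=> chern.
set g := \matrix_(i, j) randers_tensor (A u) (b u) y i j.
pose gx k i j := tensor_dx (A u) (b u) y (dmetric u k) (dform u k) i j.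
pose gy := tensor_dy (A u) (b u) y.
have chernE : chern = chern_symbol g gx gy y.
  by apply/funext => i; apply/funext => j; apply/funext => k; exact: chern_randers.
have gU : g \in unitmx by exact: randers_tensor_unit (Asym uU) (Apos uU) (Lpos uU) y y0.
have gsym i j : g i j = g j i.
  by rewrite !mxE; exact: randers_tensor_sym (Asym uU) _ _ _.
have gxsym k i j : gx k i j = gx k j i.
  by apply: tensor_dx_sym (Asym uU) _ _ _ _ _ _; exact: dmetric_sym.
have gysym l i j : gy l i j = gy l j i by exact: tensor_dy_sym (Asym uU) _ _ _ _.
have gyrad l j : \sum_s y 0 s * gy l s j = 0.
  exact: tensor_dy_radial (Asym uU) (Apos uU) _ y0 _ _.
have eqE Ga : tensor_equation u y Ga <-> chern_equation g gx gy y Ga.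
  split=> H k i j.
    rewrite /horizontal_metric H; congr (_ + _);
      by apply: eq_bigr => l _; rewrite mxE.
  have := H k i j; rewrite /horizontal_metric => ->; congr (_ + _);
    by apply: eq_bigr => l _; rewrite mxE.
rewrite chernE; split.
- by move=> i j k; exact: chern_sym.
- by apply/eqE; exact: chern_satisfies_equation.
- by move=> Ga Gsym /eqE GE; exact: chern_equation_unique.
Qed.

Lemma randers_berwald_parallel u : U u ->
  (forall i j k y y', y != 0 -> y' != 0 ->
     chern_coefficient L i j k u y = chern_coefficient L i j k u y') <->
  exists Ga, parallel u Ga.
Proof.
move=> uU; split=> [H|[Ga [Gsym GA Gb]] i j k y y' y0 y0'].
  (* Some nonzero vector at which to read off Ga, unless the dimension is 0. *)
  pose v : vec := const_mx 1.
  have v0 (y : vec) : y != 0 -> v != 0.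
    apply: contraNN => /eqP/rowP vE; apply/eqP/rowP => j.
    by have := vE j; rewrite !mxE => /eqP; rewrite oner_eq0.
  pose Ga i j k := chern_coefficient L i j k u v.
  have n0 (i : 'I_n) : v != 0.
    by apply/eqP => /rowP /(_ i); rewrite !mxE => /eqP; rewrite oner_eq0.
  exists Ga.
  have P k := @parallel_of_tensor R n (A u) (b u) (Asym uU) (Apos uU) (Lpos uU)
    (fun l r => Ga l k r) (dmetric u k) (dform u k) (dmetric_sym k uU).
  have E (y : vec) : y != 0 -> tensor_equation u y Ga.
    move=> y0; have [_ eqn _] := chern_randersP uU y0.
    suff <- : (fun i j k => chern_coefficient L i j k u y) = Ga by [].
    apply/funext => i'; apply/funext => j'; apply/funext => k'.
    by apply: H => //; exact: v0 y0.
  split=> [i j k|k i j|k i].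
  - have [S _ _] := chern_randersP uU (n0 i); exact: (S i j k).
  - have [S _] := P k (fun y y0 => E y y0 k); exact: (S i j).
  - have [_ S] := P k (fun y y0 => E y y0 k); exact: (S i).
have U1 (z : vec) : z != 0 -> chern_coefficient L i j k u z = Ga i j k.
  move=> z0; have [_ _ S] := chern_randersP uU z0; apply: (S Ga Gsym _ i j k) => k' i' j'.
  exact: (@tensor_parallel R n (A u) (b u) (Asym uU) (Apos uU) z z0
    (fun l r => Ga l k' r) (fun l => \sum_r Ga l k' r * z 0 r)
    (dmetric u k') (dform u k') (fun=> erefl) (GA k') (Gb k') i' j').
by rewrite !U1.
Qed.

End RandersChart.

(** * Parallel forms, closed forms and Killing fields *)
Section ParallelAlgebra.
Context {R : realType} {n : nat}.
Variables (A : 'M[R]_n) (xi b : 'rV[R]_n).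
Variables (dA : 'I_n -> 'I_n -> 'I_n -> R) (dxi db : 'I_n -> 'I_n -> R).
Hypotheses (Aunit : A \in unitmx) (Asym : forall i j, A i j = A j i).
Hypothesis dAsym : forall k i j, dA k i j = dA k j i.
Hypothesis bE : forall l, b 0 l = low A xi l.
Hypothesis dbE :
  forall k i, db k i = \sum_j (dA k i j * xi 0 j + A i j * dxi k j).

(** The Lie derivative of the metric along xi. *)
Definition killing_tensor i k : R :=
  \sum_l xi 0 l * dA l i k + \sum_l A i l * dxi k l + \sum_l A k l * dxi i l.

(** If b is closed, db is symmetric and equals its own symmetrization; by the
    Killing equation the latter is the pairing of xi with the Christoffel
    symbols of A, so that these make b parallel. *)
Lemma parallel_algebra :
  (exists Ga, [/\ forall i j k, Ga i j k = Ga i k j, metric_compatible A dA Ga &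
     forall k i, db k i = \sum_l Ga l k i * b 0 l]) <->
  (forall i k, db k i = db i k) /\ (forall i k, killing_tensor i k = 0).
Proof.
split=> [[Ga [Gsym GA Gb]]|[C H]].
  split=> [i k|i k].
    by rewrite !Gb; apply: eq_bigr => l _; rewrite Gsym.
  have GA' k' i' j' : dA k' i' j' =
    \sum_l Ga l k' i' * A l j' + \sum_l Ga l k' j' * A l i' by exact: GA.
  have Ea k' i' : \sum_l A i' l * dxi k' l = - \sum_j (\sum_l Ga l k' j * A l i') * xi 0 j.
    have := dbE k' i'; rewrite big_split /= Gb.
    have -> : \sum_l Ga l k' i' * b 0 l = \sum_j (\sum_l Ga l k' i' * A l j) * xi 0 j.
      under [RHS]eq_bigr do rewrite mulr_suml.
      rewrite exchange_big /=; apply: eq_bigr => l _; rewrite bE /low mulr_sumr.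
      by apply: eq_bigr => j _; ring.
    under [X in _ = X + _]eq_bigr do rewrite GA' mulrDl.
    rewrite big_split /= => /esym/eqP.
    rewrite -addrA -subr_eq0 addrAC subrr add0r addrC addr_eq0.
    by move=> /eqP.
  rewrite /killing_tensor (Ea k i) (Ea i k) -!sumrN -!big_split /=; apply: big1 => j _.
  rewrite (GA' j i k).
  have -> : \sum_l Ga l j i * A l k = \sum_l Ga l i j * A l k.
    by apply: eq_bigr => l _; rewrite Gsym.
  have -> : \sum_l Ga l j k * A l i = \sum_l Ga l k j * A l i.
    by apply: eq_bigr => l _; rewrite Gsym.
  by ring.
exists (koszul A dA); split=> [i j k|k i j|k i].
- exact: koszul_sym.
- exact: (koszul_compatible Aunit Asym dAsym).
transitivity (2^-1 * (db k i + db i k)); first by rewrite (C i k); field.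
have -> : \sum_l koszul A dA l k i * b 0 l =
    \sum_j (\sum_l koszul A dA l k i * A l j) * xi 0 j.
  under [RHS]eq_bigr do rewrite mulr_suml.
  rewrite exchange_big /=; apply: eq_bigr => l _; rewrite bE /low mulr_sumr.
  by apply: eq_bigr => j _; ring.
under [RHS]eq_bigr do rewrite (invmx_lower Aunit Asym).
have := H i k; rewrite /killing_tensor => /eqP; rewrite -addrA addrC addr_eq0 => /eqP E.
rewrite !dbE !big_split /=.
transitivity (2^-1 * (\sum_j dA k i j * xi 0 j + \sum_j dA i k j * xi 0 j
   + (\sum_l A i l * dxi k l + \sum_l A k l * dxi i l))); first by ring.
rewrite E -sumrN -!big_split mulr_sumr; apply: eq_bigr => j _ /=.
by rewrite (dAsym i j k) (dAsym j k i); ring.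
Qed.

End ParallelAlgebra.

Section ParallelKilling.
Context {R : realType} {n : nat}.
Local Notation vec := 'rV[R]_n.

Definition form_of (A : vec -> 'M[R]_n) (xi : vec -> vec) u : vec :=
  \row_i low (A u) (xi u) i.

Definition dmetric_along (A : vec -> 'M[R]_n) u (x : vec) : 'M[R]_n :=
  \matrix_(i, j) 'D_x (fun u => A u i j) u.

Definition bil (B : 'M[R]_n) (x y : vec) : R := lin (\row_i low B x i) y.

Definition closed_at (b : vec -> vec) u : Prop :=
  forall x y, lin ('D_x b u) y = lin ('D_y b u) x.

Definition killing_at (A : vec -> 'M[R]_n) (xi : vec -> vec) u : Prop :=
  forall x y, bil (dmetric_along A u (xi u)) x y
    + bil (A u) ('D_x xi u) y + bil (A u) x ('D_y xi u) = 0.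

Lemma row_delta_sum (x : vec) : x = \sum_k x 0 k *: delta_mx 0 k.
Proof.
apply/rowP => j; rewrite summxE (bigD1 j)//= !mxE !eqxx mulr1 big1 ?addr0// => k kj.
by rewrite !mxE [j == k]eq_sym (negPf kj) andbF mulr0.
Qed.

Lemma derive_expand (W : normedModType R) (f : vec -> W) u x :
  differentiable f u -> 'D_x f u = \sum_k x 0 k *: 'D_(delta_mx 0 k) f u.
Proof.
move=> df; rewrite deriveE// {1}[x]row_delta_sum linear_sum /=.
by apply: eq_bigr => k _; rewrite linearZ /= deriveE.
Qed.

Lemma bilE (B : 'M[R]_n) x y : bil B x y = \sum_i \sum_j B i j * x 0 j * y 0 i.
Proof.
by apply: eq_bigr => i _; rewrite mxE mulr_suml.
Qed.

Lemma bilinear_eq0 (F : vec -> vec -> R) (K : 'I_n -> 'I_n -> R) :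
  (forall x y, F x y = \sum_i \sum_k K i k * x 0 k * y 0 i) ->
  (forall x y, F x y = 0) <-> (forall i k, K i k = 0).
Proof.
move=> E; split=> [H i k|H x y]; last first.
  by rewrite E big1// => i _; rewrite big1// => k _; rewrite H !mul0r.
have := H (delta_mx 0 k) (delta_mx 0 i); rewrite E (bigD1 i)//= (bigD1 k)//=.
rewrite !mxE !eqxx !mulr1 big1 ?addr0; last first.
  by move=> k' k'k; rewrite !mxE (negPf k'k) andbF mulr0 mul0r.
rewrite big1 ?addr0// => i' i'i; rewrite big1// => k' _.
by rewrite !mxE (negPf i'i) andbF mulr0.
Qed.

Variables (A : vec -> 'M[R]_n) (xi : vec -> vec) (u : vec).
Hypothesis Asym : \forall z \near u, forall i j, A z i j = A z j i.
Hypothesis Apos : forall y, y != 0 -> 0 < quad (A u) y.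
Hypothesis Adiff : forall i j, differentiable (fun u => A u i j) u.
Hypothesis xidiff : differentiable xi u.
Let b := form_of A xi.

Lemma differentiable_rows (f : vec -> vec) :
  (forall i, differentiable (fun u => f u 0 i) u) -> differentiable f u.
Proof.
move=> H.
have E : f = \sum_i (fun z => f z 0 i *: delta_mx 0 i).
  by apply/funext => z; rewrite fct_sumE [LHS]row_delta_sum.
rewrite E; apply: differentiable_sum => i.
exact: differentiableZl.
Qed.

Lemma differentiable_form_entry i : differentiable (fun u => b u 0 i) u.
Proof.
rewrite (_ : (fun u => b u 0 i) = \sum_j ((fun u => A u i j) * (fun u => xi u 0 j))).
  apply: differentiable_sum => j; apply: differentiableM => //.
  exact: differentiable_entry.
by apply/funext => z; rewrite fct_sumE mxE.
Qed.

Lemma differentiable_form : differentiable b u.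
Proof. exact: differentiable_rows differentiable_form_entry. Qed.

Let dA k i j := dmetric A u k i j.
Let dxi k j := ('D_(delta_mx 0 k) xi u) 0 j.
Let db k i := dform b u k 0 i.

Let dAsym k i j : dA k i j = dA k j i.
Proof. by rewrite /dA !mxE; apply: near_eq_derive; apply: filterS Asym. Qed.

Let Au i j : A u i j = A u j i.
Proof. by have /nbhs_singleton := Asym. Qed.

Lemma dformE k i : db k i = \sum_j (dA k i j * xi u 0 j + A u i j * dxi k j).
Proof.
rewrite /db mxE.
have D j : is_derive u (delta_mx 0 k : vec) (fun u => A u i j * xi u 0 j)
    (dA k i j * xi u 0 j + A u i j * dxi k j).
  apply: is_derive_mul; first by rewrite /dA mxE; apply/derivableP/diff_derivable.
  rewrite /dxi -derive_entry//; apply/derivableP/diff_derivable.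
  exact: differentiable_entry.
rewrite -(is_derive_val (is_derive_big D)).
by congr ('D_ _ _ _); apply/funext => z; rewrite mxE.
Qed.

Lemma closed_atP : closed_at b u <-> forall i k, db k i = db i k.
Proof.
have E x y : lin ('D_x b u) y = \sum_k \sum_i x 0 k * y 0 i * db k i.
  rewrite /lin exchange_big /=; apply: eq_bigr => i _.
  rewrite (derive_expand _ differentiable_form) summxE mulr_suml.
  apply: eq_bigr => k _; rewrite /db !mxE (derive_entry _ _ _ differentiable_form) /=.
  by ring.
have F x y : lin ('D_x b u) y - lin ('D_y b u) x =
    \sum_i \sum_k (db k i - db i k) * x 0 k * y 0 i.
  apply: etrans (congr2 (fun p q => p - q) (E x y) (E y x)) _.
  rewrite /=; move: (db) => d.
  rewrite [X in X - _]exchange_big -sumrB; apply: eq_bigr => i _.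
  rewrite -sumrB; apply: eq_bigr => k _ /=.
  by ring.
have [H1 H2] := bilinear_eq0 F.
split=> [H i k|H x y]; apply/eqP; rewrite -subr_eq0; apply/eqP.
  by apply: H1 => x y; apply/eqP; rewrite subr_eq0; apply/eqP; exact: H.
by apply: H2 => i k; rewrite H subrr.
Qed.

Let K := killing_tensor (A u) (xi u) dA dxi.

Lemma killing_atP : killing_at A xi u <-> forall i k, K i k = 0.
Proof.
have E x y : bil (dmetric_along A u (xi u)) x y
    + bil (A u) ('D_x xi u) y + bil (A u) x ('D_y xi u) =
    \sum_i \sum_k K i k * x 0 k * y 0 i.
  rewrite !bilE.
  have -> : \sum_i \sum_j A u i j * ('D_x xi u) 0 j * y 0 i =
      \sum_i \sum_k (\sum_l A u i l * dxi k l) * x 0 k * y 0 i.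
    apply: eq_bigr => i _.
    transitivity (\sum_j \sum_k A u i j * dxi k j * x 0 k * y 0 i).
      apply: eq_bigr => j _; rewrite (derive_expand x xidiff) summxE.
      rewrite mulr_sumr mulr_suml; apply: eq_bigr => k _.
      by rewrite mxE /dxi; ring.
    rewrite exchange_big /=; apply: eq_bigr => k _.
    by rewrite !mulr_suml.
  have -> : \sum_i \sum_j A u i j * x 0 j * ('D_y xi u) 0 i =
      \sum_i \sum_k (\sum_l A u k l * dxi i l) * x 0 k * y 0 i.
    transitivity (\sum_j \sum_l \sum_i A u l j * x 0 j * (dxi i l * y 0 i)).
      rewrite exchange_big /=; apply: eq_bigr => j _; apply: eq_bigr => l _.
      rewrite (derive_expand y xidiff) summxE mulr_sumr; apply: eq_bigr => i _.
      by rewrite mxE /dxi; ring.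
    transitivity (\sum_j \sum_i \sum_l A u l j * x 0 j * (dxi i l * y 0 i)).
      by apply: eq_bigr => j _; rewrite exchange_big.
    rewrite exchange_big /=; apply: eq_bigr => i _; apply: eq_bigr => k _.
    by rewrite !mulr_suml; apply: eq_bigr => l _; rewrite (Au l k); ring.
  rewrite -!big_split; apply: eq_bigr => i _ /=.
  rewrite -!big_split; apply: eq_bigr => k _ /=.
  have -> : dmetric_along A u (xi u) i k = \sum_l xi u 0 l * dA l i k.
    rewrite mxE (derive_expand _ (Adiff i k)); apply: eq_bigr => l _.
    by rewrite /dA mxE.
  by rewrite !mulrDl.
exact: bilinear_eq0 E.
Qed.

Lemma metric_unit : A u \in unitmx.
Proof.
rewrite -row_free_unit -kermx_eq0; apply/rowV0P => v /sub_kermxP vA.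
apply/eqP/negPn/negP => /Apos; rewrite (_ : quad (A u) v = 0) ?ltxx//.
transitivity (\sum_j (v *m A u) 0 j * v 0 j).
  apply: eq_bigr => j _; rewrite !mxE; congr (_ * _); apply: eq_bigr => i _.
  by rewrite (Au i j); ring.
by rewrite vA big1// => j _; rewrite mxE mul0r.
Qed.

Lemma parallel_killing :
  (exists Ga, parallel A b u Ga) <-> closed_at b u /\ killing_at A xi u.
Proof.
rewrite closed_atP killing_atP.
have bE l : b u 0 l = low (A u) (xi u) l by rewrite mxE.
have [P1 P2] := parallel_algebra metric_unit Au dAsym bE dformE.
split=> [[Ga [G1 G2 G3]]|/P2[Ga [G1 G2 G3]]]; last by exists Ga.
by apply: P1; exists Ga.
Qed.

(** A frame of fields on which the metric and the form take constant values.
    Differentiating these constants expresses dA and db at u through the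
    derivatives of the frame, and only brackets survive. *)
Section Frame.
Variable E : vec -> vec -> vec.
Hypothesis Ediff : forall v, differentiable (E v) u.
Hypothesis Esurj : forall x, exists v, E v u = x.
Hypothesis Emetric : forall v w,
  \forall z \near u, bil (A z) (E v z) (E w z) = bil (A u) (E v u) (E w u).
Hypothesis Eform : forall w, \forall z \near u, lin (b z) (E w z) = lin (b u) (E w u).

Definition bracket_at (V W : vec -> vec) (u : vec) : vec :=
  'D_(V u) W u - 'D_(W u) V u.

Lemma lin_sub (c x y : vec) : lin c (x - y) = lin c x - lin c y.
Proof. by rewrite /lin -sumrB; apply: eq_bigr => i _; rewrite !mxE mulrBr. Qed.

Lemma derive_frame_form w z : lin ('D_z b u) (E w u) = - lin (b u) ('D_z (E w) u).
Proof.
have D : is_derive u z (fun x => lin (b x) (E w x))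
    (lin ('D_z b u) (E w u) + lin (b u) ('D_z (E w) u)).
  apply: is_derive_lin => j.
    rewrite -(derive_entry _ _ _ differentiable_form).
    by apply/derivableP/diff_derivable; exact: differentiable_form_entry.
  rewrite -(derive_entry _ _ _ (Ediff w)).
  by apply/derivableP/diff_derivable; exact: differentiable_entry.
have := is_derive_val D; rewrite (near_eq_derive _ (Eform w)) derive_cst.
by move=> /eqP; rewrite eq_sym addr_eq0 => /eqP.
Qed.

Lemma closed_frame : closed_at b u <->
  forall v w, lin (b u) (bracket_at (E v) (E w) u) = 0.
Proof.
split=> [H v w|H x y].
  have HE := etrans (esym (derive_frame_form w (E v u)))
    (etrans (H (E v u) (E w u)) (derive_frame_form v (E w u))).
  by rewrite /bracket_at lin_sub (oppr_inj HE) subrr.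
have [v <-] := Esurj x; have [w <-] := Esurj y.
have := H v w; rewrite /bracket_at lin_sub => /eqP.
rewrite subr_eq0 => /eqP HE.
exact: etrans (derive_frame_form w (E v u)) (etrans (congr1 -%R HE)
  (esym (derive_frame_form v (E w u)))).
Qed.

Lemma bil_sub_l (B : 'M[R]_n) x x' y : bil B (x - x') y = bil B x y - bil B x' y.
Proof.
rewrite !bilE -sumrB; apply: eq_bigr => i _; rewrite -sumrB; apply: eq_bigr => j _.
by rewrite !mxE; ring.
Qed.

Lemma bil_sub_r (B : 'M[R]_n) x y y' : bil B x (y - y') = bil B x y - bil B x y'.
Proof. exact: lin_sub. Qed.

Lemma derive_frame_metric v w z :
  bil (dmetric_along A u z) (E v u) (E w u) + bil (A u) ('D_z (E v) u) (E w u)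
  + bil (A u) (E v u) ('D_z (E w) u) = 0.
Proof.
have DE v' j : is_derive u z (fun x => E v' x 0 j) (('D_z (E v') u) 0 j).
  rewrite -(derive_entry _ _ _ (Ediff v')).
  by apply/derivableP/diff_derivable; exact: differentiable_entry.
have DA i j : is_derive u z (fun x => A x i j) (dmetric_along A u z i j).
  by rewrite mxE; apply/derivableP/diff_derivable.
have D : is_derive u z (fun x => bil (A x) (E v x) (E w x))
    (lin (\row_i (low (dmetric_along A u z) (E v u) i + low (A u) ('D_z (E v) u) i)) (E w u)
     + lin (\row_i low (A u) (E v u) i) ('D_z (E w) u)).
  apply: is_derive_lin => // j; rewrite mxE; under eq_fun do rewrite mxE.
  exact: is_derive_low.
have := is_derive_val D; rewrite (near_eq_derive _ (Emetric v w)) derive_cst => ->.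
congr (_ + _); rewrite /bil /lin -big_split; apply: eq_bigr => i _ /=.
by rewrite !mxE mulrDl.
Qed.

Lemma killing_frame : killing_at A xi u <->
  forall v w, bil (A u) (bracket_at xi (E v) u) (E w u)
    + bil (A u) (E v u) (bracket_at xi (E w) u) = 0.
Proof.
have EK v w : bil (A u) (bracket_at xi (E v) u) (E w u)
    + bil (A u) (E v u) (bracket_at xi (E w) u) =
  - (bil (dmetric_along A u (xi u)) (E v u) (E w u)
    + bil (A u) ('D_(E v u) xi u) (E w u) + bil (A u) (E v u) ('D_(E w u) xi u)).
  rewrite /bracket_at bil_sub_l bil_sub_r.
  have sub (m p q p' q' : R) : m + p' + q' = 0 ->
    (p' - p) + (q' - q) = - (m + p + q) by lra.
  exact: sub (derive_frame_metric v w (xi u)).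
split=> [H v w|H x y]; first by rewrite EK H oppr0.
have [v <-] := Esurj x; have [w <-] := Esurj y.
by have := H v w; rewrite EK => /eqP; rewrite oppr_eq0 => /eqP.
Qed.

End Frame.
End ParallelKilling.

(** * Differentials in charts and naturality of the bracket *)
Lemma is_derive_rows {R : realType} (V : normedModType R) m
    (f : V -> 'rV[R]_m) z v (df : 'rV[R]_m) :
  (forall j, is_derive z v (fun x => f x 0 j) (df 0 j)) -> is_derive z v f df.
Proof.
move=> H.
have fd : derivable f z v by apply/derivable_mxP => i j; rewrite ord1; case: (H j).
split=> //; rewrite derive_mx//; apply/rowP => j; rewrite mxE.
exact: is_derive_val (H j).
Qed.

Lemma is_derive_scale {R : realType} (V : normedModType R) m (k : V -> R)
    (f : V -> 'rV[R]_m) z v dk : is_derive z v k dk -> differentiable f z ->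
  is_derive z v (fun x => k x *: f x) (dk *: f z + k z *: 'D_v f z).
Proof.
move=> Dk df; apply: is_derive_rows => j.
have Df : is_derive z v (fun x => f x 0 j) (('D_v f z) 0 j).
  rewrite -(derive_entry _ _ _ df); apply/derivableP/diff_derivable.
  exact: differentiable_entry.
have := is_derive_mul Dk Df; rewrite !mxE.
by under [X in _ -> is_derive _ _ X _]eq_fun do rewrite mxE.
Qed.

(** A map phi carrying X to X' and Y to Y' carries the bracket to the bracket:
    differentiating Y' (phi z) = dphi_z (Y z) along X produces the second
    derivative of phi at (X, Y), which cancels by symmetry. *)
Section BracketNaturality.
Context {R : realType} {n : nat}.
Local Notation vec := 'rV[R]_n.
Variables (phi : vec -> vec) (u : vec).
Hypothesis phidiff : \forall z \near u, differentiable phi z.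
Hypothesis dphidiff : forall v, differentiable ('D_v phi) u.

Lemma derive_pushforward (X X' Y Y' : vec -> vec) :
  differentiable Y u -> differentiable Y' (phi u) ->
  X' (phi u) = 'D_(X u) phi u ->
  (\forall z \near u, Y' (phi z) = 'D_(Y z) phi z) ->
  'D_(X' (phi u)) Y' (phi u) =
  'D_('D_(X u) Y u) phi u + 'D_(X u) ('D_(Y u) phi) u.
Proof.
move=> dY dY' XE YE.
have dphi : differentiable phi u by exact: nbhs_singleton phidiff.
have -> : 'D_(X' (phi u)) Y' (phi u) = 'D_(X u) (Y' \o phi) u.
  rewrite XE (deriveE _ dY') (deriveE _ dphi) deriveE; last exact: differentiable_comp.
  exact: esym (congr1 (@^~ (X u)) (diff_comp dphi dY')).
have E1 : \forall z \near u, (Y' \o phi) z =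
    \sum_k Y z 0 k *: 'D_(delta_mx 0 k) phi z.
  near=> z; rewrite /= (near YE z)//; apply: derive_expand.
  by near: z.
rewrite (near_eq_derive _ E1).
have DY k : is_derive u (X u) (fun z => Y z 0 k) (('D_(X u) Y u) 0 k).
  rewrite -(derive_entry _ _ _ dY); apply/derivableP/diff_derivable.
  exact: differentiable_entry.
have Dk k : is_derive u (X u) (fun z => Y z 0 k *: 'D_(delta_mx 0 k) phi z)
  (('D_(X u) Y u) 0 k *: 'D_(delta_mx 0 k) phi u
   + Y u 0 k *: 'D_(X u) ('D_(delta_mx 0 k) phi) u).
  exact: is_derive_scale (DY k) (dphidiff _).
rewrite (_ : (fun z => _) = \sum_k (fun z => Y z 0 k *: 'D_(delta_mx 0 k) phi z));
  last by apply/funext => z; rewrite fct_sumE.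
rewrite (is_derive_val (is_derive_sum Dk)) big_split /=; congr (_ + _).
  by rewrite (derive_expand _ dphi).
have E2 : \forall z \near u, 'D_(Y u) phi z =
    (\sum_k (Y u 0 k *: 'D_(delta_mx 0 k) phi)) z.
  by apply: filterS phidiff => z dz; rewrite fct_sumE; exact: derive_expand.
rewrite (near_eq_derive _ E2).
have D2 k : is_derive u (X u) (Y u 0 k *: 'D_(delta_mx 0 k) phi)
    (Y u 0 k *: 'D_(X u) ('D_(delta_mx 0 k) phi) u).
  by apply: is_deriveZ; apply: derivableP; apply: diff_derivable.
by rewrite (is_derive_val (is_derive_sum D2)).
Unshelve. all: by end_near. Qed.

Lemma bracket_natural (X X' Y Y' : vec -> vec) :
  differentiable X u -> differentiable X' (phi u) ->
  differentiable Y u -> differentiable Y' (phi u) ->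
  (\forall z \near u, X' (phi z) = 'D_(X z) phi z) ->
  (\forall z \near u, Y' (phi z) = 'D_(Y z) phi z) ->
  bracket_at X' Y' (phi u) = 'D_(bracket_at X Y u) phi u.
Proof.
move=> dX dX' dY dY' XE YE.
have dphi : differentiable phi u by exact: nbhs_singleton phidiff.
have XE0 := nbhs_singleton XE; have YE0 := nbhs_singleton YE.
rewrite /bracket_at (derive_pushforward dY dY' XE0 YE).
rewrite (derive_pushforward dX dX' YE0 XE).
have C : 'D_(X u) ('D_(Y u) phi) u = 'D_(Y u) ('D_(X u) phi) u by exact: derive_comm_rV.
have cancel (p q r r' : vec) : r = r' -> (p + r) - (q + r') = p - q.
  by move=> ->; rewrite opprD addrACA subrr addr0.
apply: etrans (cancel _ _ _ _ C) _.
by rewrite !(deriveE _ dphi) linearB.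
Qed.

End BracketNaturality.

Lemma diff_comp_near {R : realType} (U V W : normedModType R) (f : U -> V)
    (g : V -> W) (k : U -> W) x y :
  f x = y -> differentiable f x -> differentiable g y ->
  (\forall z \near x, g (f z) = k z) ->
  differentiable k x /\ 'd k x = 'd g y \o 'd f x :> (U -> W).
Proof.
move=> <- df dg E; have [D1 D2] := near_eq_diff E (differentiable_comp df dg).
by split=> //; exact: etrans D2 (diff_comp df dg).
Qed.

Section TangentMaps.
Context {R : realType} {n : nat} {M : smoothManifoldType R n}.
Local Notation vec := 'rV[R]_n.
Implicit Types (c : chart R n M) (x : M) (f h : M -> M).

(** The tangent map of f at x in the natural coordinates of c and c'.  Tangent
    maps, components and coordinate changes are all instances of it, so that
    the chain rule [Dmap_comp] handles them uniformly. *)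
Definition Dmap c c' f x : vec -> vec := 'd (c' \o f \o cinv c) (c x).

Definition rep_diff c c' f x := differentiable (c' \o f \o cinv c) (c x).

Lemma cimg_coord c x : cdom c x -> cimg c (c x).
Proof. by exists x. Qed.

Lemma cinv_dom c u : cimg c u -> cdom c (cinv c u).
Proof. by move=> [x cx <-]; rewrite coordK. Qed.

Lemma cinvK c u : cimg c u -> c (cinv c u) = u.
Proof. by move=> [x cx <-]; rewrite coordK. Qed.

Lemma near_cimg c u : cimg c u -> \forall z \near u, cimg c z.
Proof. by move=> cu; exact: open_nbhs_nbhs (conj (@cimg_open _ _ _ c) cu). Qed.

Lemma near_cinv c x (P : set M) : cdom c x -> nbhs x P ->
  \forall z \near c x, P (cinv c z).
Proof.
move=> cx Px.
have H : {for c x, continuous (cinv c)} by exact: (@cinv_continuous _ _ _ c _ (cimg_coord cx)).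
by apply: H; rewrite coordK.
Qed.

Lemma near_cdom c x : cdom c x -> nbhs x (cdom c).
Proof. by move=> cx; exact: open_nbhs_nbhs (conj (cdom_open c) cx). Qed.

Lemma Dmap_comp c1 c2 c3 f h x : cdom c1 x -> cdom c2 (f x) ->
  {for x, continuous f} -> rep_diff c1 c2 f x -> rep_diff c2 c3 h (f x) ->
  rep_diff c1 c3 (h \o f) x /\
  Dmap c1 c3 (h \o f) x = Dmap c2 c3 h (f x) \o Dmap c1 c2 f x.
Proof.
move=> x1 x2 fx df dh.
have E : \forall z \near c1 x, (c3 \o h \o cinv c2) ((c2 \o f \o cinv c1) z) =
    (c3 \o (h \o f) \o cinv c1) z.
  have : nbhs x (f @^-1` cdom c2) by apply: fx; exact: near_cdom.
  by move=> /(near_cinv x1); apply: filterS => z /= z2; rewrite coordK.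
apply: diff_comp_near df dh E.
by rewrite /= coordK.
Qed.

Lemma Dmap_id c x : cdom c x -> rep_diff c c id x /\ Dmap c c id x = id.
Proof.
move=> cx.
have E : \forall z \near c x, z = (c \o id \o cinv c) z.
  by apply: filterS (near_cimg (cimg_coord cx)) => z cz /=; rewrite cinvK.
have I : is_diff (c x) (@id vec) id by exact: is_diff_id.
have [D1 D2] := near_eq_diff (f := id) E (@ex_diff _ _ _ _ _ _ _ I).
split; first exact: D1.
exact: etrans D2 (@diff_val _ _ _ _ _ _ _ I).
Qed.

Lemma rep_diff_id c c' x : atlas c -> atlas c' -> cdom c x -> cdom c' x ->
  rep_diff c c' id x.
Proof.
move=> ac ac' cx c'x; have [+ _] := atlas_compatible c c' ac ac'.
by move=> /(_ [::] (c x)); apply; split; [exact: cimg_coord|rewrite coordK].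
Qed.

Lemma Dmap_comp_val c1 c2 c3 f h x v : cdom c1 x -> cdom c2 (f x) ->
  {for x, continuous f} -> rep_diff c1 c2 f x -> rep_diff c2 c3 h (f x) ->
  Dmap c2 c3 h (f x) (Dmap c1 c2 f x v) = Dmap c1 c3 (h \o f) x v.
Proof.
move=> x1 x2 fx df dh; have [_ E] := Dmap_comp x1 x2 fx df dh.
exact: esym (congr1 (@^~ v) E).
Qed.

Lemma componentsE c x (v : tangent x) :
  components c v = Dmap (chart_at x) c id x v.
Proof. by []. Qed.

Lemma of_componentsE c u y : cimg c u ->
  of_components c u y = Dmap c (chart_at (cinv c u)) id (cinv c u) y.
Proof. by move=> cu; rewrite /Dmap cinvK. Qed.

Lemma componentsK c u y : atlas c -> cimg c u ->
  components c (of_components c u y) = y.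
Proof.
move=> ac cu; rewrite componentsE of_componentsE//.
have cx := cinv_dom cu; set x := cinv c u in cx *.
rewrite (@Dmap_comp_val c (chart_at x) c id id x y)//.
- by have [_ ->] := Dmap_id cx.
- exact: chart_at_dom.
- by apply: rep_diff_id => //; [exact: chart_at_atlas|exact: chart_at_dom].
- by apply: rep_diff_id => //; [exact: chart_at_atlas|exact: chart_at_dom].
Qed.

Lemma of_componentsK c u (v : vec) : atlas c -> cimg c u ->
  of_components c u (@components _ _ _ c (cinv c u) v) = v.
Proof.
move=> ac cu; rewrite of_componentsE// componentsE.
have cx := cinv_dom cu; set x := cinv c u in cx *.
rewrite (@Dmap_comp_val (chart_at x) c (chart_at x) id id x v)//.
- by have [_ ->] := Dmap_id (chart_at_dom x).
- exact: chart_at_dom.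
- by apply: rep_diff_id => //; [exact: chart_at_atlas|exact: chart_at_dom].
- by apply: rep_diff_id => //; [exact: chart_at_atlas|exact: chart_at_dom].
Qed.

End TangentMaps.

(** * Left-invariant frames in charts *)
Section LieGroupFrame.
Context {R : realType} {n : nat} {G : lieGroupType R n}.
Local Notation vec := 'rV[R]_n.
Local Notation c1 := (chart_at (1%g : G)).
Implicit Types (c : chart R n G) (g h x : G) (v w : vec).

Lemma left_translation_continuous g x : {for x, continuous (left_translation g)}.
Proof.
have H : {for x, continuous (fun y : G => (g, y))}.
  by apply: cvg_pair; [exact: cvg_cst|exact: cvg_id].
exact: (continuous_comp H (lie_mul_continuous (g, x))).
Qed.

Definition chart_mul c c2 c3 (p : vec * vec) : vec :=
  c3 (cinv c p.1 * cinv c2 p.2)%g.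

Definition insert_right (u : vec) (w : vec) : vec * vec := (u, w).
Definition insert_left (w : vec) (u : vec) : vec * vec := (u, w).

Lemma insert_right_diff u w :
  differentiable (insert_right u) w /\
  'd (insert_right u) w = (fun v => (0, v)) :> (vec -> vec * vec).
Proof.
have H : is_diff w (insert_right u) (fun v => (0, v)).
  exact: (is_diff_pair (is_diff_cst u w) (is_diff_id w)).
by split; [exact: ex_diff|rewrite diff_val].
Qed.

Lemma insert_left_diff w u : differentiable (insert_left w) u.
Proof.
have H : is_diff u (insert_left w) (fun v => (v, 0)).
  exact: (is_diff_pair (is_diff_id u) (is_diff_cst w u)).
exact: ex_diff.
Qed.

Section Charts.
Variables (c c2 c3 : chart R n G).
Hypotheses (ac : atlas c) (ac2 : atlas c2) (ac3 : atlas c3).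

Lemma chart_mul_smooth s (u w : vec) : cimg c u -> cimg c2 w ->
  cdom c3 (cinv c u * cinv c2 w)%g ->
  differentiable (iter_derive (chart_mul c c2 c3) s) (u, w).
Proof.
by move=> cu cw cd; apply: (@lie_mul_smooth R n G c c2 c3 ac ac2 ac3 s (u, w)).
Qed.

Lemma chart_mul_right_diff (u w : vec) : cimg c u -> cimg c2 w ->
  cdom c3 (cinv c u * cinv c2 w)%g ->
  differentiable (c3 \o left_translation (cinv c u) \o cinv c2) w /\
  forall v, 'D_v (c3 \o left_translation (cinv c u) \o cinv c2) w =
    'D_((0, v) : vec * vec) (chart_mul c c2 c3) (u, w).
Proof.
move=> cu cw cd.
have [i1 i2] := insert_right_diff u w.
have dm := chart_mul_smooth [::] cu cw cd; rewrite /iter_derive /= in dm.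
have E : \forall z \near w, chart_mul c c2 c3 (insert_right u z) =
  (c3 \o left_translation (cinv c u) \o cinv c2) z by near=> z.
have [D1 D2] := diff_comp_near (y := (u, w)) erefl i1 dm E.
split; first exact: D1.
move=> v; rewrite (deriveE _ D1) (deriveE _ dm).
by apply: etrans (congr1 (@^~ v) D2) _; rewrite /= i2.
Unshelve. all: by end_near. Qed.

End Charts.

Lemma left_rep_diff c2 c3 g x : atlas c2 -> atlas c3 -> cdom c2 x ->
  cdom c3 (g * x)%g -> rep_diff c2 c3 (left_translation g) x.
Proof.
move=> ac2 ac3 x2 x3; pose c := chart_at g.
have gE : cinv c (c g) = g by rewrite coordK//; exact: chart_at_dom.
have [] := @chart_mul_right_diff c c2 c3 (chart_at_atlas g) ac2 ac3 (c g) (c2 x).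
- by apply: cimg_coord; exact: chart_at_dom.
- exact: cimg_coord.
- by rewrite gE coordK.
by rewrite gE.
Qed.

Definition frame c v : vec -> vec :=
  local_field c (left_invariant_field (v : lie_algebra G)).

Lemma frameE c v u : atlas c -> cimg c u ->
  frame c v u = Dmap c1 c (left_translation (cinv c u)) 1%g v.
Proof.
move=> ac cu; rewrite /frame /local_field componentsE /left_invariant_field.
have cx := cinv_dom cu; set x := cinv c u in cx *.
have x1 : left_translation x 1%g = x by exact: mulg1.
have -> : tangent_map (left_translation x) 1%g v =
    Dmap c1 (chart_at x) (left_translation x) 1%g v.
  by rewrite /tangent_map /Dmap x1.
have H := @Dmap_comp_val R n G c1 (chart_at x) c (left_translation x) id 1%g v.
rewrite x1 in H; apply: H.
- exact: chart_at_dom.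
- exact: chart_at_dom.
- exact: left_translation_continuous.
- apply: left_rep_diff; rewrite ?mulg1; by [exact: chart_at_atlas|exact: chart_at_dom].
- by apply: rep_diff_id => //; [exact: chart_at_atlas|exact: chart_at_dom].
Qed.

(** In charts a left-invariant field is a partial derivative of the
    multiplication at the identity; its smoothness follows from this. *)
Lemma frame_derive c v u : atlas c -> cimg c u ->
  frame c v u = 'D_((0, v) : vec * vec) (chart_mul c c1 c) (u, c1 1%g).
Proof.
move=> ac cu; rewrite frameE//.
have cw : cimg c1 (c1 1%g) by apply: cimg_coord; exact: chart_at_dom.
have cd : cdom c (cinv c u * cinv c1 (c1 1%g))%g.
  by rewrite coordK ?mulg1; [exact: cinv_dom|exact: chart_at_dom].
have [D1 D2] := chart_mul_right_diff ac (chart_at_atlas _) ac cu cw cd.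
by rewrite -D2 (deriveE _ D1).
Qed.

Lemma frame_diff c v u : atlas c -> cimg c u -> differentiable (frame c v) u.
Proof.
move=> ac cu.
have E : \forall z \near u, 'D_((0, v) : vec * vec) (chart_mul c c1 c)
    (insert_left (c1 1%g) z) = frame c v z.
  by apply: filterS (near_cimg cu) => z cz; rewrite frame_derive.
have cw : cimg c1 (c1 1%g) by apply: cimg_coord; exact: chart_at_dom.
have cd : cdom c (cinv c u * cinv c1 (c1 1%g))%g.
  by rewrite coordK ?mulg1; [exact: cinv_dom|exact: chart_at_dom].
have dm := chart_mul_smooth ac (chart_at_atlas _) ac [:: (0, v)] cu cw cd.
by have [] := diff_comp_near (y := (u, c1 1%g)) erefl (insert_left_diff _ _) dm E.
Qed.

Lemma Dmap_translations ca cb cc g h x v : atlas ca -> atlas cb -> atlas cc ->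
  cdom ca x -> cdom cb (h * x)%g -> cdom cc (g * h * x)%g ->
  Dmap cb cc (left_translation g) (h * x)%g (Dmap ca cb (left_translation h) x v) =
  Dmap ca cc (left_translation (g * h)%g) x v.
Proof.
move=> aa ab ac xa xb xc.
have -> : left_translation (g * h)%g = left_translation g \o left_translation h.
  by apply/funext => z; rewrite /left_translation /= mulgA.
apply: Dmap_comp_val => //.
- exact: left_translation_continuous.
- exact: left_rep_diff.
- by apply: left_rep_diff => //; rewrite /left_translation mulgA.
Qed.

Lemma left_translation1 : left_translation (1%g : G) = id.
Proof. by apply/funext => x; rewrite /left_translation mul1g. Qed.

Lemma frame_at1 v : frame c1 v (c1 1%g) = v.
Proof.
have d1 : cdom c1 1%g by exact: chart_at_dom.
rewrite frameE; [|exact: chart_at_atlas|exact: cimg_coord].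
by rewrite coordK// left_translation1; have [_ ->] := Dmap_id d1.
Qed.

Lemma frame_surj c u y : atlas c -> cimg c u -> exists v, frame c v u = y.
Proof.
move=> ac cu; have cx := cinv_dom cu; set x := cinv c u in cx *.
exists (Dmap c c1 (left_translation x^-1%g) x y); rewrite frameE// -/x.
have := @Dmap_translations c c1 c x x^-1%g x y ac (chart_at_atlas _) ac cx.
rewrite mulVg mulgV mul1g => -> //; last exact: chart_at_dom.
by rewrite left_translation1; have [_ ->] := Dmap_id cx.
Qed.

(** The bracket that defines ad is computed at 1; left translation by the point
    of coordinates u, read in charts, carries left-invariant fields to
    themselves and hence transports the bracket to u. *)
Lemma frame_bracket c v w u : atlas c -> cimg c u ->
  bracket_at (frame c v) (frame c w) u =
  frame c (ad (v : lie_algebra G) (w : lie_algebra G)) u.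
Proof.
move=> ac cu; have cx := cinv_dom cu; set g := cinv c u in cx.
have d1 : cdom c1 1%g by exact: chart_at_dom.
have a1 : atlas c1 by exact: chart_at_atlas.
pose phi := c \o left_translation g \o cinv c1; pose u1 := c1 1%g.
have phiu : phi u1 = u by rewrite /phi /= coordK// /left_translation mulg1 cinvK.
have N1 : \forall z \near u1, cimg c1 z /\ cdom c (g * cinv c1 z)%g.
  near=> z; split; near: z; first by apply: near_cimg; exact: cimg_coord.
  apply: (near_cinv (P := fun h => cdom c (g * h)%g)) => //.
  have H : {for 1%g, continuous (left_translation g)} by exact: left_translation_continuous.
  apply: (H (cdom c)).
  by apply: near_cdom; rewrite /left_translation mulg1.
have Nd : \forall z \near u1, differentiable phi z.
  apply: filterS N1 => z [cz dz]; have := left_rep_diff a1 ac (cinv_dom cz) dz.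
  by rewrite /rep_diff cinvK.
have gE : cinv (chart_at g) (chart_at g g) = g by rewrite coordK//; exact: chart_at_dom.
have cg : cimg (chart_at g) (chart_at g g) by apply: cimg_coord; exact: chart_at_dom.
have Dphi y : \forall z \near u1, 'D_((0, y) : vec * vec) (chart_mul (chart_at g) c1 c)
    (insert_right (chart_at g g) z) = 'D_y phi z.
  apply: filterS N1 => z [cz dz].
  have [|_ D2] := chart_mul_right_diff (chart_at_atlas g) a1 ac cg cz.
    by rewrite gE.
  by rewrite gE in D2; rewrite D2.
have Ndd y : differentiable ('D_y phi) u1.
  have [i1 _] := insert_right_diff (chart_at g g) u1.
  have dm : differentiable ('D_((0, y) : vec * vec) (chart_mul (chart_at g) c1 c))
      (chart_at g g, u1).
    apply: (chart_mul_smooth (chart_at_atlas g) a1 ac [:: (0, y)] cg).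
      exact: cimg_coord.
    by rewrite gE coordK// mulg1.
  by have [] := diff_comp_near (y := (chart_at g g, u1)) erefl i1 dm (Dphi y).
(* Left-invariance of the frame: L_(gh) = L_g o L_h. *)
have push y : \forall z \near u1, frame c y (phi z) = 'D_(frame c1 y z) phi z.
  near=> z.
  have dz : differentiable phi z by near: z.
  have [cz cdz] : cimg c1 z /\ cdom c (g * cinv c1 z)%g by near: z.
  set h := cinv c1 z in cdz.
  have kE : cinv c (phi z) = (g * h)%g by rewrite /phi /= coordK.
  have F1 := frameE y ac (cimg_coord cdz : cimg c (phi z)); rewrite kE in F1.
  have F2 := frameE y a1 cz; rewrite -/h in F2.
  rewrite F1 F2 (deriveE _ dz).
  have T : Dmap c1 c (left_translation g) (h * 1)%g
      (Dmap c1 c1 (left_translation h) 1%g y) =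
      Dmap c1 c (left_translation (g * h)%g) 1%g y.
    by apply: Dmap_translations => //; rewrite mulg1//; exact: cinv_dom.
  rewrite mulg1 in T.
  have E : Dmap c1 c (left_translation g) h = 'd phi z :> (vec -> vec).
    by rewrite /Dmap /h cinvK.
  by rewrite -T E.
have cu1 : cimg c1 u1 by exact: cimg_coord.
have cphi : cimg c (phi u1) by rewrite phiu.
have B := bracket_natural Nd Ndd (frame_diff v a1 cu1) (frame_diff v ac cphi)
  (frame_diff w a1 cu1) (frame_diff w ac cphi) (push v) (push w).
pose A : vec := ad (v : lie_algebra G) (w : lie_algebra G).
have adE : bracket_at (frame c1 v) (frame c1 w) u1 = A by [].
have P : frame c A (phi u1) = 'D_(frame c1 A u1) phi u1 := nbhs_singleton (push A).
have A1 : frame c1 A u1 = A := frame_at1 A.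
have Q : bracket_at (frame c v) (frame c w) (phi u1) = frame c A (phi u1).
  exact: etrans B (etrans (congr1 (fun q => 'D_q phi u1) (etrans adE (esym A1))) (esym P)).
by case: _ / phiu Q.
Unshelve. all: by end_near. Qed.

End LieGroupFrame.

(** * Left-invariant Randers metrics *)
Section InvariantRanders.
Context {R : realType} {n : nat} {G : lieGroupType R n}.
Local Notation vec := 'rV[R]_n.
Variables (a : forall x : G, tangent x -> tangent x -> R).
Variables (X : forall x : G, tangent x) (F : forall x : G, tangent x -> R).
Hypothesis randersF : randers_metric a X F.

Let m (x : G) (v w : vec) : R := a (x := x) v w.
Let Xv (x : G) : vec := X x.
Let LI (v : vec) (x : G) : vec := left_invariant_field (v : lie_algebra G) x.

Let mlin x k v v' w : m x (k *: v + v') w = k * m x v w + m x v' w.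
Proof. by have [[H _ _ _] _ _ _] := randersF; exact: H. Qed.

Let msym x v w : m x v w = m x w v.
Proof. by have [[_ H _ _] _ _ _] := randersF; exact: H. Qed.

Let mpos x v : v != 0 -> 0 < m x v v.
Proof. by have [[_ _ H _] _ _ _] := randersF; exact: H. Qed.

Let msmooth c (v w : vec) : atlas c -> smooth_on (cimg c)
  (fun u => m (cinv c u) (of_components c u v) (of_components c u w)).
Proof. by have [[_ _ _ H] _ _ _] := randersF => ac; exact: H. Qed.

Let Xsmooth : smooth_vector_field X.
Proof. by case: randersF. Qed.

Let Xnorm x : m x (Xv x) (Xv x) < 1.
Proof. by have [_ _ H _] := randersF; exact: H. Qed.

Let FE x (y : vec) : F (x := x) y = Num.sqrt (m x y y) + m x (Xv x) y.
Proof. by have [_ _ _ H] := randersF; exact: H. Qed.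

Let mDl x v v' w : m x (v + v') w = m x v w + m x v' w.
Proof. by have := mlin x 1 v v' w; rewrite scale1r mul1r. Qed.

Let m0l x w : m x 0 w = 0.
Proof. by have := mlin x (-1) 0 0 w; rewrite scaler0 addr0 mulN1r addNr. Qed.

Let mZl x k v w : m x (k *: v) w = k * m x v w.
Proof. by rewrite -[k *: v]addr0 mlin m0l addr0. Qed.

Let mNl x v w : m x (- v) w = - m x v w.
Proof. by rewrite -scaleN1r mZl mulN1r. Qed.

Let mDr x v w w' : m x v (w + w') = m x v w + m x v w'.
Proof. by rewrite msym mDl !(msym x _ v). Qed.

Let mZr x k v w : m x v (k *: w) = k * m x v w.
Proof. by rewrite msym mZl (msym x _ v). Qed.

Let mNr x v w : m x v (- w) = - m x v w.
Proof. by rewrite msym mNl (msym x _ v). Qed.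

(** By the Cauchy-Schwarz inequality the form has norm less than 1, as X has. *)
Lemma randers_pos x (y : vec) : y != 0 -> 0 < Num.sqrt (m x y y) + m x (Xv x) y.
Proof.
move=> y0; have q0 := mpos x y0; set q := m x y y in q0 *; set t := m x (Xv x) y.
have qn : q != 0 by rewrite gt_eqF.
have CS : t ^+ 2 < q.
  have : 0 <= m x (Xv x - (t / q) *: y) (Xv x - (t / q) *: y).
    have [->|z0] := eqVneq (Xv x - (t / q) *: y) 0; first by rewrite m0l.
    exact: ltW (mpos x z0).
  rewrite !(mDl, mDr, mNl, mNr, mZl, mZr) (msym x y) -/t -/q.
  rewrite (_ : _ + _ = m x (Xv x) (Xv x) - t ^+ 2 / q); last by field.
  by rewrite subr_ge0 => /le_lt_trans/(_ (Xnorm x)); rewrite ltr_pdivrMr// mul1r.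
have s0 : 0 < Num.sqrt q by rewrite sqrtr_gt0.
have s2 : Num.sqrt q ^+ 2 = q by rewrite sqr_sqrtr// ltW.
by rewrite -s2 in CS; move: (Num.sqrt q) s0 CS => s s0 CS; nra.
Qed.

Section Invariance.
Hypothesis invF : left_invariant_metric F.

Lemma LI_opp v x : LI (- v) x = - LI v x.
Proof. exact: linearN. Qed.

Lemma LI_add v w x : LI (v + w) x = LI v x + LI w x.
Proof. exact: linearD. Qed.

Lemma norm_invariant g v : Num.sqrt (m g (LI v g) (LI v g)) + m g (Xv g) (LI v g) =
  Num.sqrt (m 1%g v v) + m 1%g (Xv 1%g) v.
Proof.
have H z : z = left_translation g 1%g -> F (x := z) (LI v g) = F (x := 1%g) v.
  by move=> ->; exact: invF.
by have := H g (esym (mulg1 g)); rewrite !FE.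
Qed.

(** Comparing the invariance of F at v and at - v separates the norm, which is
    even, from the form, which is odd. *)
Lemma metric_form_invariant g v : m g (LI v g) (LI v g) = m 1%g v v /\
  m g (Xv g) (LI v g) = m 1%g (Xv 1%g) v.
Proof.
have H1 := norm_invariant g v; have H2 := norm_invariant g (- v).
rewrite LI_opp !(mNl, mNr) !opprK in H2.
have nn x w : 0 <= m x w w.
  have [->|w0] := eqVneq w 0; first by rewrite m0l.
  exact: ltW (mpos x w0).
split; last by lra.
have : Num.sqrt (m g (LI v g) (LI v g)) = Num.sqrt (m 1%g v v) by lra.
by move=> /(congr1 (fun s => s ^+ 2)); rewrite !sqr_sqrtr.
Qed.

Lemma metric_invariant g v w : m g (LI v g) (LI w g) = m 1%g v w.
Proof.
have [Hv _] := metric_form_invariant g v; have [Hw _] := metric_form_invariant g w.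
have [] := metric_form_invariant g (v + w).
rewrite LI_add !(mDl, mDr) Hv Hw (msym g (LI w g)) (msym _ w); lra.
Qed.

Lemma LI_surj x z : exists v, LI v x = z.
Proof.
pose c := chart_at x; have cx : cdom c x := chart_at_dom x.
have ac : atlas c := chart_at_atlas x.
have cu := cimg_coord cx.
have [v vE] := frame_surj (components c (z : tangent x)) ac cu.
exists v.
have H y : y = cinv c (c x) -> of_components c (c x) (frame c v (c x)) = LI v y.
  by move=> ->; exact: of_componentsK.
have K y : y = cinv c (c x) ->
  of_components c (c x) (@components _ _ _ c y z) = z.
  by move=> ->; exact: of_componentsK.
by rewrite -H ?coordK// vE; apply: K; rewrite coordK.
Qed.

(** The form X determines is left-invariant and the metric is nondegenerate. *)
Lemma field_invariant x : Xv x = LI (Xv 1%g) x.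
Proof.
apply/eqP; rewrite -subr_eq0; apply/negPn/negP => d0.
have [w wE] := LI_surj x (Xv x - LI (Xv 1%g) x).
have := mpos x d0; rewrite -{2}wE mDl mNl metric_invariant.
by have [_ ->] := metric_form_invariant x w; rewrite subrr ltxx.
Qed.

Section Chart.
Variable c : chart R n G.
Hypothesis ac : atlas c.

Let A (u : vec) : 'M[R]_n := \matrix_(i, j)
  m (cinv c u) (of_components c u (delta_mx 0 i)) (of_components c u (delta_mx 0 j)).

Let xi : vec -> vec := local_field c X.

Let AbilE u y z : bil (A u) y z = m (cinv c u) (of_components c u y) (of_components c u z).
Proof.
have sl x (w : vec) (f : 'I_n -> vec) (k : 'I_n -> R) :
    m x (\sum_i k i *: f i) w = \sum_i k i * m x (f i) w.
  elim: (index_enum _) => [|i s IH]; first by rewrite !big_nil m0l.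
  by rewrite !big_cons mDl mZl IH.
have oE (y' : vec) : of_components c u y' =
    \sum_i y' 0 i *: (of_components c u (delta_mx 0 i) : vec).
  rewrite {1}(row_delta_sum y') /of_components linear_sum.
  by apply: eq_bigr => i _; rewrite linearZ.
rewrite bilE (oE y) (oE z) msym sl; apply: eq_bigr => i _.
rewrite msym sl mulr_sumr; apply: eq_bigr => j _.
by rewrite mxE msym; ring.
Qed.

Let Asym u i j : A u i j = A u j i.
Proof. by rewrite !mxE msym. Qed.

Let Aquad u y : quad (A u) y = m (cinv c u) (of_components c u y) (of_components c u y).
Proof. by rewrite -AbilE. Qed.

Let of_components_neq0 u (y : vec) : cimg c u -> y != 0 ->
  (of_components c u y : vec) != 0.
Proof.
move=> cu; apply: contraNN => /eqP E.
have := componentsK y ac cu; rewrite E => <-.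
by apply/eqP; rewrite /components linear0.
Qed.

Let Apos u : cimg c u -> forall y, y != 0 -> 0 < quad (A u) y.
Proof. by move=> cu y y0; rewrite Aquad mpos// of_components_neq0. Qed.

Let oxi u : cimg c u -> of_components c u (xi u) = Xv (cinv c u).
Proof. by move=> cu; exact: of_componentsK. Qed.

Let linb u y : cimg c u ->
  lin (form_of A xi u) y = m (cinv c u) (Xv (cinv c u)) (of_components c u y).
Proof. by move=> cu; rewrite -[LHS]/(bil (A u) (xi u) y) AbilE oxi. Qed.

Let LE u : cimg c u -> forall y,
  local_finsler c F u y = randers (A u) (form_of A xi u) y.
Proof.
by move=> cu y; rewrite /local_finsler FE /randers Aquad linb.
Qed.

Let Lpos u : cimg c u -> forall y, y != 0 -> 0 < randers (A u) (form_of A xi u) y.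
Proof.
by move=> cu y y0; rewrite /randers Aquad linb// randers_pos// of_components_neq0.
Qed.

Let Adiff u : cimg c u -> forall i j, differentiable (fun u => A u i j) u.
Proof.
move=> cu i j.
have := msmooth (delta_mx 0 i) (delta_mx 0 j) ac [::] cu.
rewrite /iter_derive /=; congr (differentiable _ _).
by apply/funext => z; rewrite mxE.
Qed.

Let xidiff u : cimg c u -> differentiable xi u.
Proof. by move=> cu; exact: (Xsmooth ac [::] cu). Qed.

Let bdiff u : cimg c u -> forall i, differentiable (fun u => form_of A xi u 0 i) u.
Proof.
by move=> cu i; apply: differentiable_form_entry; [exact: Adiff|exact: xidiff].
Qed.

Lemma frame_of_components v u : cimg c u ->
  of_components c u (frame c v u) = LI v (cinv c u).
Proof. by move=> cu; exact: of_componentsK. Qed.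

Let xiE : xi = frame c (Xv 1%g).
Proof.
apply/funext => u; rewrite /xi /frame /local_field; congr components.
exact: field_invariant.
Qed.

Lemma bil_frame (y z v w : vec) u : cimg c u -> y = frame c v u -> z = frame c w u ->
  bil (A u) y z = m 1%g v w.
Proof.
move=> cu -> ->; apply: etrans (AbilE _ _ _) _.
apply: etrans (metric_invariant (cinv c u) v w).
exact: congr2 (frame_of_components v cu) (frame_of_components w cu).
Qed.

Lemma lin_frame (z w : vec) u : cimg c u -> z = frame c w u ->
  lin (form_of A xi u) z = m 1%g (Xv 1%g) w.
Proof.
move=> cu ->; apply: (bil_frame (v := Xv 1%g) cu) => //.
exact: (congr1 (@^~ u) xiE).
Qed.

(** The condition on the Lie algebra is the same for all charts and points;
    hence one point decides it, and it gives Berwald type at all of them. *)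
Lemma berwald_at_iff u : cimg c u ->
  (forall i j k (y y' : vec), y != 0 -> y' != 0 ->
     chern_coefficient (local_finsler c F) i j k u y =
     chern_coefficient (local_finsler c F) i j k u y') <->
  (forall v w : vec, m 1%g (Xv 1%g) (ad (v : lie_algebra G) (w : lie_algebra G)) = 0) /\
  (forall v w : vec,
     m 1%g (ad (Xv 1%g : lie_algebra G) (v : lie_algebra G)) w
     + m 1%g v (ad (Xv 1%g : lie_algebra G) (w : lie_algebra G)) = 0).
Proof.
move=> cu.
apply: iff_trans (randers_berwald_parallel (@cimg_open _ _ _ c) LE
  (fun u _ => Asym u) Apos Lpos Adiff bdiff cu) _.
have Asn : \forall z \near u, forall i j, A z i j = A z j i by near=> z.
apply: iff_trans (parallel_killing Asn (Apos cu) (Adiff cu) (xidiff cu)) _.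
have Ed v : differentiable (frame c v) u by exact: frame_diff.
have Es x : exists v, frame c v u = x by exact: frame_surj.
have Em v w : \forall z \near u, bil (A z) (frame c v z) (frame c w z) =
    bil (A u) (frame c v u) (frame c w u).
  apply: filterS (near_cimg cu) => z cz.
  exact: etrans (bil_frame cz erefl erefl) (esym (bil_frame cu erefl erefl)).
have Ef w : \forall z \near u, lin (form_of A xi z) (frame c w z) =
    lin (form_of A xi u) (frame c w u).
  apply: filterS (near_cimg cu) => z cz.
  exact: etrans (lin_frame cz erefl) (esym (lin_frame cu erefl)).
have C := closed_frame (Adiff cu) (xidiff cu) Ed Es Ef.
have K := killing_frame xi (Adiff cu) Ed Es Em.
have CE v w : lin (form_of A xi u) (bracket_at (frame c v) (frame c w) u) =
    m 1%g (Xv 1%g) (ad (v : lie_algebra G) (w : lie_algebra G)).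
  exact: lin_frame cu (frame_bracket v w ac cu).
have KE v w : bil (A u) (bracket_at xi (frame c v) u) (frame c w u)
    + bil (A u) (frame c v u) (bracket_at xi (frame c w) u) =
  m 1%g (ad (Xv 1%g : lie_algebra G) (v : lie_algebra G)) w
     + m 1%g v (ad (Xv 1%g : lie_algebra G) (w : lie_algebra G)).
  rewrite xiE; congr (_ + _).
    exact: bil_frame cu (frame_bracket (Xv 1%g) v ac cu) erefl.
  exact: bil_frame cu erefl (frame_bracket (Xv 1%g) w ac cu).
split=> [[/C H1 /K H2]|[H1 H2]].
  split=> v w; first exact: etrans (esym (CE v w)) (H1 v w).
  exact: etrans (esym (KE v w)) (H2 v w).
split; [apply: C.2|apply: K.2] => v w.
  exact: etrans (CE v w) (H1 v w).
exact: etrans (KE v w) (H2 v w).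
Unshelve. all: by end_near. Qed.

End Chart.
End Invariance.
End InvariantRanders.

Theorem theorem3p6 (R : realType) (n : nat) (G : lieGroupType R n)
    (a : forall x : G, tangent x -> tangent x -> R)
    (X : forall x : G, tangent x)
    (F : forall x : G, tangent x -> R)
    (randersF : randers_metric a X F)
    (invF : left_invariant_metric F) :
  berwald_type F <->
  skew_adjoint (a (1%g : G)) (ad (X (1%g : G))) /\
  (forall Y Z : lie_algebra G, a (1%g : G) (X (1%g : G)) (ad Y Z) = 0).
Proof.
have I := @berwald_at_iff R n G a X F randersF invF.
split=> [B|[S C] c ac u cu].
  have a1 : atlas (chart_at (1%g : G)) := chart_at_atlas _.
  have cu := cimg_coord (chart_at_dom (1%g : G)).
  have [+ _] := I _ a1 _ cu.
  move=> /(_ (B _ a1 _ cu)) [H1 H2]; split; last exact: H1.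
  by move=> v w; apply/eqP; rewrite -addr_eq0; apply/eqP; exact: H2.
have [_ +] := I _ ac _ cu; apply; split; first exact: C.
by move=> v w; apply/eqP; rewrite addr_eq0; apply/eqP; exact: S.
Qed.
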